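(* Let $r\in\mathbb{R}$ and $q\in\mathbb{C}$, and let $\nabla$ be the $\mathrm{SU}(4)$-invariant metric affine connection with totally skew-symmetric torsion on $\mathbb{S}^7$ given by $$\nabla_XY=\nabla^g_XY+r\big(\Phi_1(X,Y)\,\xi_1-\eta_1(X)\psi_1(Y)+\eta_1(Y)\psi_1(X)\big)+\mathrm{Re}(q)\Theta(X,Y)+\mathrm{Im}(q)\widetilde\Theta(X,Y).$$ Then $$\mathrm{Sym}(\mathrm{Ric}^\nabla)=(6-2r^2-4|q|^2)\,g+4(|q|^2-r^2)\,\eta_1\otimes\eta_1,\qquad s^\nabla=6(7-3r^2-4|q|^2).$$ In particular, $(\mathbb{S}^7,g,\nabla)$ is $\nabla$-Einstein if and only if $|q|^2=r^2$, and in this case $\mathrm{Sym}(\mathrm{Ric}^\nabla)=6(1-r^2)\,g$.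
   Context: $\mathrm{SU}(4)$ acts on the unit sphere $\mathbb{S}^7\subset\mathbb{C}^4$ by matrix multiplication; write $\tau_\sigma(p)=\sigma p$. For a vector field $X$, $\tau_\sigma(X)_p=(\tau_\sigma)_*(X_{\sigma^{-1}p})$. An affine connection $\nabla$ is $\mathrm{SU}(4)$-invariant if $\tau_\sigma(\nabla_XY)=\nabla_{\tau_\sigma(X)}\tau_\sigma(Y)$ for all $\sigma\in\mathrm{SU}(4)$ and all vector fields $X,Y$. $g$ is the canonical Riemannian metric of constant sectional curvature $1$ and $\nabla^g$ its Levi-Civita connection. $\nabla$ is metric if $\nabla g=0$ (its torsion need not vanish). Its torsion is $T^\nabla(X,Y)=\nabla_XY-\nabla_YX-[X,Y]$, and $\nabla$ has totally skew-symmetric torsion if $\omega_\nabla(X,Y,Z)=g(T^\nabla(X,Y),Z)$ is a $3$-form. 3-Sasakian structure: identify $\mathbb{C}^4\cong\mathbb{H}^2$ by $(z_1,z_2,z_3,z_4)\mapsto(z_1+z_2\mathbf{j},z_3+z_4\mathbf{j})$, and let $\mathbf{i},\mathbf{j},\mathbf{k}$ act by left multiplication. With $N$ the unit outward normal, set $\xi_1(z)=-\mathbf{i}z$, $\xi_2(z)=-\mathbf{j}z$, $\xi_3(z)=-\mathbf{k}z$, and define $(1,1)$-tensors $\psi_s$ and $1$-forms $\eta_s$ by the decompositions into tangent and normal parts $\mathbf{i}X=\psi_1(X)+\eta_1(X)N$, $\mathbf{j}X=\psi_2(X)+\eta_2(X)N$, $\mathbf{k}X=\psi_3(X)+\eta_3(X)N$.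 Put $\Phi_s(X,Y)=g(X,\psi_s(Y))$, so $d\eta_s=2\Phi_s$. Let $\Omega=\frac12(\eta_2\wedge d\eta_2-\eta_3\wedge d\eta_3)=\eta_2\wedge\Phi_2-\eta_3\wedge\Phi_3$ (where $\eta\wedge\Phi$ evaluated on $(X,Y,Z)$ is the cyclic sum of $\eta(X)\Phi(Y,Z)$). The tensors $\Theta,\widetilde\Theta$ are defined by $g(\Theta(X,Y),Z)=\Omega(X,Y,Z)$ and $g(\widetilde\Theta(X,Y),Z)=\Omega(X,Y,\psi_1(Z))$. Curvature: $R^\nabla(X,Y)Z=\nabla_X\nabla_YZ-\nabla_Y\nabla_XZ-\nabla_{[X,Y]}Z$, $\mathrm{Ric}^\nabla(Y,Z)=\mathrm{tr}(X\mapsto R^\nabla(X,Y)Z)$, $s^\nabla$ is the $g$-trace of $\mathrm{Ric}^\nabla$, and $\mathrm{Sym}$ denotes the symmetric part. $(M,g,\nabla)$ is $\nabla$-Einstein if $\nabla$ is metric, has totally skew-symmetric torsion and $\mathrm{Sym}(\mathrm{Ric}^\nabla)=\frac{s^\nabla}{\dim M}g$. *)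

(* Defs.v *)
From HB Require Import structures.
From mathcomp Require Import all_boot all_order all_algebra.
From mathcomp Require Import all_classical all_reals all_analysis.
From mathcomp Require Import complex ring.

Set Implicit Arguments.
Unset Strict Implicit.
Unset Printing Implicit Defensive.

Import Order.TTheory GRing.Theory Num.Theory.
Import numFieldNormedType.Exports.

Local Open Scope ring_scope.

(** * The sphere [S7] as a submanifold of [R^8 = C^4] *)

Notation R8 R := 'cV[R]_8.

Definition dot (R : realType) (x y : R8 R) : R := \sum_(i < 8) x i 0 * y i 0.

Definition S7 (R : realType) := {p : R8 R | dot p p == 1}.

Section Sphere.
Context {R : realType}.
Local Notation E := (R8 R).
Local Notation S7 := (S7 R).

Definition basis (i : 'I_8) : E := delta_mx i 0.

Lemma dot_delta (x : E) (i : 'I_8) : dot x (basis i) = x i 0.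
Proof.
rewrite /dot (bigD1 i) //= mxE !eqxx mulr1 big1 ?addr0 // => j ji.
by rewrite mxE (negbTE ji) mulr0.
Qed.

Lemma base_point_subproof : dot (basis 0) (basis 0) == 1 :> R.
Proof. by rewrite dot_delta mxE !eqxx. Qed.

Definition base_point : S7 := Sub (basis 0) base_point_subproof.

(* The retraction [x |-> x / |x|] of [R^8 \ {0}] onto the sphere. *)
Definition normalize (x : E) : S7 :=
  insubd base_point ((Num.sqrt (dot x x))^-1 *: x).

(* Extension to [R^8 \ {0}], constant along rays; [f] is smooth on the
   sphere iff this extension is smooth away from the origin, and differentials
   of [f] are restrictions of differentials of the extension. *)
Definition radext (V : Type) (f : S7 -> V) (x : E) : V := f (normalize x).

Definition iter_derive (V : normedModType R) (vs : seq E) (F : E -> V) : E -> V :=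
  foldr (fun v G => fun x => 'D_v G x) F vs.

(* C^infinity: all iterated directional derivatives are differentiable. *)
Definition smooth (V : normedModType R) (f : S7 -> V) : Prop :=
  forall (vs : seq E) (x : E), x != 0 ->
    differentiable (iter_derive vs (radext f)) x.

Definition deriv_along (V : normedModType R) (X : S7 -> E) (f : S7 -> V)
  : S7 -> V := fun p => 'D_(X p) (radext f) (val p).

Definition tangent (p : S7) (v : E) : Prop := dot v (val p) = 0.

Definition vector_field (X : S7 -> E) : Prop :=
  smooth X /\ forall p, tangent p (X p).

Definition tproj (p : S7) (v : E) : E := v - dot v (val p) *: val p.

(* A tangent vector field with value [v] at [p] whenever [v] is tangent at [p]. *)
Definition ext (v : E) : S7 -> E := fun p => tproj p v.

(* The derivation [X Y - Y X] applied to the ambient coordinate functions. *)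
Definition lie_bracket (X Y : S7 -> E) : S7 -> E :=
  fun p => deriv_along X Y p - deriv_along Y X p.

(* [R^8] is the orthogonal sum of the tangent space [T_p] and the normal line,
   so the traces over [T_p] below can be computed on [R^8] after projecting. *)
Definition trace_at (p : S7) (L : E -> E) : R :=
  \sum_(i < 8) dot (L (tproj p (basis i))) (basis i).

Definition gtrace_at (p : S7) (B : E -> E -> R) : R :=
  \sum_(i < 8) B (tproj p (basis i)) (tproj p (basis i)).

(* The tangent vector at [p] that represents the linear form [w] on [T_p]. *)
Definition sharp (p : S7) (w : E -> R) : E :=
  \sum_(i < 8) w (tproj p (basis i)) *: tproj p (basis i).

Lemma dotC (x y : E) : dot x y = dot y x.
Proof. by apply: eq_bigr => i _; rewrite mulrC. Qed.

Lemma dotP (a : R) (x y z : E) : dot (a *: x + y) z = a * dot x z + dot y z.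
Proof.
rewrite /dot mulr_sumr -big_split; apply: eq_bigr => i _ /=.
by rewrite !mxE mulrDl mulrA.
Qed.

Lemma dot_tproj (p : S7) (v z : E) : tangent p z -> dot (tproj p v) z = dot v z.
Proof.
move=> pz; rewrite /tproj addrC -scaleNr dotP (dotC (val p)).
by rewrite [dot z _]pz mulr0 add0r.
Qed.

Lemma tangent_tproj (p : S7) (v : E) : tangent p (tproj p v).
Proof.
by rewrite /tangent /tproj addrC -scaleNr dotP (eqP (valP p)) mulr1 addNr.
Qed.

Lemma tproj_tangent (p : S7) (z : E) : tangent p z -> tproj p z = z.
Proof. by move=> pz; rewrite /tproj [dot z _]pz scale0r subr0. Qed.

Lemma dot_sharp (p : S7) (w : E -> R) (z : E) :
  (forall a x y, w (a *: x + y) = a * w x + w y) -> tangent p z ->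
  dot (sharp p w) z = w z.
Proof.
move=> wl pz.
have dot0 : dot 0 z = 0 by rewrite /dot big1 // => i _; rewrite mxE mul0r.
have w0 : w 0 = 0.
  by have /esym/eqP := wl 1 0 0; rewrite scale1r addr0 mul1r -subr_eq0 addrK => /eqP.
have t0 : tproj p 0 = 0 by rewrite /tproj dotC /dot big1 ?scale0r ?subr0 // => i _; rewrite mxE mulr0.
have tl a x y : tproj p (a *: x + y) = a *: tproj p x + tproj p y.
  by rewrite /tproj dotP scalerDl -scalerA scalerBr opprD addrACA.
have -> : w z = w (tproj p (\sum_(i < 8) z i 0 *: basis i)).
  congr w; rewrite -[LHS](tproj_tangent pz); congr tproj.
  by rewrite [LHS]matrix_sum_delta; apply: eq_bigr => i _; rewrite big_ord1.
rewrite /sharp; elim/big_rec2: _ => [|i u v _ IH]; first by rewrite t0 w0.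
by rewrite dotP tl wl -IH dot_tproj // dotC dot_delta mulrC.
Qed.

Lemma tangent_sharp (p : S7) (w : E -> R) : tangent p (sharp p w).
Proof.
rewrite /tangent /sharp; elim/big_rec: _ => [|i u _ IH].
  by rewrite /dot big1 // => i _; rewrite mxE mul0r.
by rewrite dotP IH addr0 tangent_tproj mulr0.
Qed.

End Sphere.

(** * Affine connections on [S7] with its round metric *)

Section Connections.
Context {R : realType}.
Local Notation E := (R8 R).
Local Notation S7 := (S7 R).
Local Notation field := (S7 -> E).

Definition g (X Y : field) : S7 -> R := fun p => dot (X p) (Y p).

(* Connections are only ever constrained and used on vector fields. *)
Implicit Types nabla : field -> field -> field.

Definition affine_connection nabla : Prop :=
  (forall X Y, vector_field X -> vector_field Y -> vector_field (nabla X Y)) /\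
  (forall X X' Y, vector_field X -> vector_field X' -> vector_field Y ->
     nabla (fun p => X p + X' p) Y = fun p => nabla X Y p + nabla X' Y p) /\
  (forall (f : S7 -> R) X Y, smooth (f : S7 -> R^o) ->
     vector_field X -> vector_field Y ->
     nabla (fun p => f p *: X p) Y = fun p => f p *: nabla X Y p) /\
  (forall X Y Y', vector_field X -> vector_field Y -> vector_field Y' ->
     nabla X (fun p => Y p + Y' p) = fun p => nabla X Y p + nabla X Y' p) /\
  (forall (f : S7 -> R) X Y, smooth (f : S7 -> R^o) ->
     vector_field X -> vector_field Y ->
     nabla X (fun p => f p *: Y p) =
     fun p => deriv_along X (f : S7 -> R^o) p *: Y p + f p *: nabla X Y p).

Definition metric_connection nabla : Prop :=
  forall X Y Z, vector_field X -> vector_field Y -> vector_field Z ->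
    forall p, deriv_along X (g Y Z : S7 -> R^o) p =
              g (nabla X Y) Z p + g Y (nabla X Z) p.

Definition torsion nabla (X Y : field) : field :=
  fun p => nabla X Y p - nabla Y X p - lie_bracket X Y p.

Definition levi_civita nabla : Prop :=
  affine_connection nabla /\ metric_connection nabla /\
  forall X Y, vector_field X -> vector_field Y ->
    forall p, torsion nabla X Y p = 0.

(* Homogeneity and additivity in the first argument extend to the others by
   skew-symmetry. *)
Definition three_form (w : field -> field -> field -> S7 -> R) : Prop :=
  (forall X Y Z, vector_field X -> vector_field Y -> vector_field Z ->
     smooth (w X Y Z : S7 -> R^o)) /\
  (forall X X' Y Z, vector_field X -> vector_field X' -> vector_field Y ->
     vector_field Z -> forall p,
     w (fun a => X a + X' a) Y Z p = w X Y Z p + w X' Y Z p) /\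
  (forall (f : S7 -> R) X Y Z, smooth (f : S7 -> R^o) ->
     vector_field X -> vector_field Y -> vector_field Z -> forall p,
     w (fun a => f a *: X a) Y Z p = f p * w X Y Z p) /\
  (forall X Y Z, vector_field X -> vector_field Y -> vector_field Z ->
     forall p, w Y X Z p = - w X Y Z p /\ w X Z Y p = - w X Y Z p).

Definition skew_torsion nabla : Prop :=
  three_form (fun X Y Z => g (torsion nabla X Y) Z).

Definition curvature nabla (X Y Z : field) : field :=
  fun p => nabla X (nabla Y Z) p - nabla Y (nabla X Z) p
           - nabla (lie_bracket X Y) Z p.

(* [curvature nabla X Y Z p] depends on [X] only through [X p]; hence the
   endomorphism of [T_p] is evaluated at [v] by extending [v] to a field. *)
Definition Ric nabla (Y Z : field) : S7 -> R :=
  fun p => trace_at p (fun v => curvature nabla (ext v) Y Z p).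

Definition SymRic nabla (Y Z : field) : S7 -> R :=
  fun p => (Ric nabla Y Z p + Ric nabla Z Y p) / 2.

Definition scalar_curvature nabla : S7 -> R :=
  fun p => gtrace_at p (fun v w => Ric nabla (ext v) (ext w) p).

Definition nabla_einstein nabla : Prop :=
  metric_connection nabla /\ skew_torsion nabla /\
  forall Y Z, vector_field Y -> vector_field Z ->
    forall p, SymRic nabla Y Z p = scalar_curvature nabla p / 7 * g Y Z p.

End Connections.

(** * The 3-Sasakian structure and the action of [SU(4)] *)

Section Sasaki.
Context {R : realType}.
Local Notation E := (R8 R).
Local Notation S7 := (S7 R).
Local Notation C := R[i].

(* [z_a = x_a + i x_(4+a)]; [dot] is then the real part of the Hermitian
   product. *)
Definition toC (x : E) : 'cV[C]_4 :=
  \col_(a < 4) Complex (x (lshift 4 a) 0) (x (rshift 4 a) 0).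

Definition ofC (z : 'cV[C]_4) : E :=
  col_mx (map_mx (@complex.Re R) z) (map_mx (@complex.Im R) z).

Definition mact (s : 'M[C]_4) (x : E) : E := ofC (s *m toC x).

Definition tau (s : 'M[C]_4) (p : S7) : S7 := insubd p (mact s (val p)).

Local Open Scope sesquilinear_scope.

Lemma dot_toC (x : E) :
  (Complex (dot x x) 0) = ((toC x) ^t* *m toC x) 0 0.
Proof.
rewrite !mxE (_ : dot x x = \sum_(a < 4)
  (x (lshift 4 a) 0 ^+ 2 + x (rshift 4 a) 0 ^+ 2)).
  rewrite -[LHS]/((real_complex R) _) rmorph_sum; apply: eq_bigr => a _ /=.
  by rewrite !mxE; simpc; congr Complex; ring.
rewrite big_split /dot (@big_split_ord _ _ _ 4 4) /=.
by congr (_ + _); apply: eq_bigr.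
Qed.

Lemma val_tau (s : 'M[C]_4) (p : S7) :
  s \is unitarymx -> val (tau s p) = mact s (val p).
Proof.
move=> su; rewrite /tau val_insubd ifT //.
have toCK z : toC (ofC z) = z.
  apply/matrixP => a j; rewrite ord1 !mxE !(unsplitK (inl _)) !(unsplitK (inr _)).
  by rewrite !mxE; case: (z a 0).
have : Complex (dot (mact s (val p)) (mact s (val p))) 0 = Complex 1 0.
  have p1 : dot (val p) (val p) = 1 by exact/eqP/(valP p).
  rewrite -[in RHS]p1.
  rewrite !dot_toC /mact toCK trmx_mul map_mxM /= -mulmxA (mulmxA _ s).
  move: su; rewrite -trmxC_unitary => /unitarymxP; rewrite trmxCK => ->.
  by rewrite mul1mx.
by case=> ->.
Qed.

(* [mact s] is real linear, hence it is its own differential. *)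
Definition push (s : 'M[C]_4) (X : S7 -> E) : S7 -> E :=
  fun p => mact s (X (tau (invmx s) p)).

Definition SU4_invariant (nabla : (S7 -> E) -> (S7 -> E) -> (S7 -> E)) : Prop :=
  forall s : 'M[C]_4, s \is unitarymx -> \det s = 1 ->
  forall X Y, vector_field X -> vector_field Y ->
    push s (nabla X Y) = nabla (push s X) (push s Y).

(* The pair [(z, w)] stands for the quaternion [z + w j], with [j w = w^* j]. *)
Definition qmul (u v : C * C) : C * C :=
  (u.1 * v.1 - u.2 * conjc v.2, u.1 * v.2 + u.2 * conjc v.1).

Definition qi : C * C := (Complex 0 1, 0).
Definition qj : C * C := (0, 1).
Definition qk : C * C := qmul qi qj.

Definition qunit (s : 'I_3) : C * C := tnth [tuple qi; qj; qk] s.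

Definition toH (x : E) : (C * C) * (C * C) :=
  let z := toC x in ((z 0 0, z 1 0), (z 2 0, z 3 0)).

Definition ofH (h : (C * C) * (C * C)) : E :=
  ofC (\col_(a < 4) tnth [tuple h.1.1; h.1.2; h.2.1; h.2.2] a).

Definition qact (u : C * C) (x : E) : E :=
  ofH (qmul u (toH x).1, qmul u (toH x).2).

(* The indices 0, 1, 2 correspond to i, j, k; the outward normal at [p] is [p]. *)
Definition xi (s : 'I_3) (p : S7) : E := - qact (qunit s) (val p).

Definition eta (s : 'I_3) (p : S7) (x : E) : R := dot (qact (qunit s) x) (val p).

Definition psi (s : 'I_3) (p : S7) (x : E) : E :=
  qact (qunit s) x - eta s p x *: val p.

Definition Phi (s : 'I_3) (p : S7) (x y : E) : R := dot x (psi s p y).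

Definition eta_wedge_Phi (s : 'I_3) (p : S7) (x y z : E) : R :=
  eta s p x * Phi s p y z + eta s p y * Phi s p z x + eta s p z * Phi s p x y.

Definition Omega (p : S7) (x y z : E) : R :=
  eta_wedge_Phi 1 p x y z - eta_wedge_Phi 2 p x y z.

Definition Theta (p : S7) (x y : E) : E := sharp p (Omega p x y).

Definition Theta_tilde (p : S7) (x y : E) : E :=
  sharp p (fun z => Omega p x y (psi 0 p z)).

Lemma qact_linear (u : C * C) (a : R) (x y : E) :
  qact u (a *: x + y) = a *: qact u x + qact u y.
Proof.
have toCD k : toC (a *: x + y) k 0 = (real_complex R a) * toC x k 0 + toC y k 0.
  by rewrite !mxE; simpc.
have ofCD z w : ofC (real_complex R a *: z + w) = a *: ofC z + ofC w.
  apply/matrixP => i j; rewrite !mxE.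
  case: fintype.split => b; rewrite !mxE;
    by case: (z b _) => z1 z2; case: (w b _) => w1 w2; simpc.
have conjD (z w : C) :
    conjc (real_complex R a * z + w) = real_complex R a * conjc z + conjc w.
  by case: z => z1 z2; case: w => w1 w2; simpc; congr Complex; ring.
rewrite /qact /ofH -ofCD; congr ofC; apply/matrixP => k j; rewrite ord1.
rewrite !mxE !(tnth_nth 0) /toH /= !toCD /qmul /= !conjD.
move: (toC x 0 0) (toC x 1 0) (toC x 2 0) (toC x 3 0).
move: (toC y 0 0) (toC y 1 0) (toC y 2 0) (toC y 3 0).
move: (real_complex R a) => c y0 y1 y2 y3 x0 x1 x2 x3.
by case: k => [[|[|[|[|m]]]] hk] //=; ring.
Qed.

Lemma eta_linear s p (a : R) (x y : E) :
  eta s p (a *: x + y) = a * eta s p x + eta s p y.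
Proof. by rewrite /eta qact_linear dotP. Qed.

Lemma psi_linear s p (a : R) (x y : E) :
  psi s p (a *: x + y) = a *: psi s p x + psi s p y.
Proof.
rewrite /psi eta_linear qact_linear scalerDl -scalerA scalerBr opprD.
by rewrite addrACA.
Qed.

Lemma Omega_linear p (x y : E) (a : R) (z t : E) :
  Omega p x y (a *: z + t) = a * Omega p x y z + Omega p x y t.
Proof.
have Phi_r s u : Phi s p u (a *: z + t) = a * Phi s p u z + Phi s p u t.
  by rewrite /Phi psi_linear dotC dotP (dotC _ u) (dotC _ u).
have Phi_l s u : Phi s p (a *: z + t) u = a * Phi s p z u + Phi s p t u.
  exact: dotP.
have wedgeD s : eta_wedge_Phi s p x y (a *: z + t) =
    a * eta_wedge_Phi s p x y z + eta_wedge_Phi s p x y t.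
  rewrite /eta_wedge_Phi Phi_r Phi_l eta_linear.
  move: (eta s p) (Phi s p) => e f; ring.
rewrite /Omega (wedgeD 1) (wedgeD 2).
by move: (eta_wedge_Phi) => w; ring.
Qed.

Lemma ThetaP p (x y z : E) :
  tangent p z -> dot (Theta p x y) z = Omega p x y z.
Proof. by move=> pz; rewrite dot_sharp //; exact: Omega_linear. Qed.

Lemma Theta_tildeP p (x y z : E) :
  tangent p z -> dot (Theta_tilde p x y) z = Omega p x y (psi 0 p z).
Proof.
move=> pz; rewrite dot_sharp // => a u v.
by rewrite psi_linear Omega_linear.
Qed.

Definition nabla_rq (nablag : (S7 -> E) -> (S7 -> E) -> (S7 -> E))
    (r : R) (q : C) (X Y : S7 -> E) : S7 -> E :=
  fun p => nablag X Y p
    + r *: (Phi 0 p (X p) (Y p) *: xi 0 p - eta 0 p (X p) *: psi 0 p (Y p)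
            + eta 0 p (Y p) *: psi 0 p (X p))
    + complex.Re q *: Theta p (X p) (Y p)
    + complex.Im q *: Theta_tilde p (X p) (Y p).

End Sasaki.

(* Main.v *)
(* Write [nabla = nabla^g + A] with [A] the given tensor. On tangent vectors [A]
   restricts multilinear expressions on R^8 in the left multiplications by i, j, k,
   and [<A(x,y),z>] is totally skew; so [nabla] is metric with torsion [2 A].

   The Levi-Civita connection is [D_X Y + <X,Y> p], by uniqueness. Evaluating
   [<R(X,Y)Z,X> + <R(X,Z)Y,X>] at p with X the projection of a constant vector
   (for which [nabla^g X] vanishes at p), every term containing a derivative of
   [A] is skew in Y, Z and cancels. With the curvature of the round sphere this
   leaves, summing over a frame,
     [Sym Ric(Y,Z) = 6 <Y,Z> - sum_i <A(e_i,Y),A(e_i,Z)>],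
   and the last sum is a polynomial identity in the coordinates of p, Y, Z.

   Invariance under SU(4) holds because left multiplication by i is complex
   scalar multiplication, and [<Theta(x,y),z>] is the real part of the complex
   determinant of (p, x, y, z). *)

From HB Require Import structures.
Require Import Defs.
From mathcomp Require Import all_boot all_order all_algebra.
From mathcomp Require Import all_classical all_reals all_analysis.
From mathcomp Require Import complex ring lra.
Import Order.TTheory GRing.Theory Num.Theory.
Import numFieldNormedType.Exports.
Local Open Scope ring_scope.

Set Implicit Arguments.
Unset Strict Implicit.
Unset Printing Implicit Defensive.

(* Not [basis], which MathComp-Analysis shadows. *)
Local Notation e_ := Defs.basis.

(** Fields on the sphere are differentiated through extensions constant along rays, which are
    controlled only off the origin; hence the punctured space. The obstacle is iteration: the
    derivative of such an extension has degree $-1$, so it is not the extension of the derived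
    field. The two differ by the factor $|x|$, which is stationary in tangent directions. Flat
    second derivatives can therefore be used in the curvature, and their symmetry comes from the
    mean value theorem.

    In the final sum over a frame, the ambient form of [A] kills normal vectors, so the standard
    basis of R^8 replaces the projected one. Each slot map then has rank two up to a multiple of
    [J], and the sum becomes a few inner products. The products of [r] with the parts of [q] vanish.
    The $\eta_1\otimes\eta_1$ term records how the direction $ip$ differs from its complement: the
    [r] part of the sum is 6 there instead of 2, the [q] part 0 instead of 4. *)

Section NearDifferentiable.
Context {R : numFieldType} {V W : normedModType R}.

(** A first-order expansion of [f] at [x] is also one of [h], and [diff_unique] identifies the
    differential. This transports regularity between functions that agree only off the origin. *)
Lemma near_eq_differentiable (f h : V -> W) (x : V) :
  {near x, f =1 h} -> differentiable f x -> differentiable h x.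
Proof.
move=> fh df.
have hE : h \o shift x = cst (h x) + 'd f x +o_ 0 id.
  have <- : f x = h x by exact: (nbhs_singleton fh).
  apply/eqaddoP => _/posnumP[e].
  have /eqaddoP /(_ e%:num) /(_ [gt0 of e%:num]) := diff_locally df.
  apply: filter_app.
  move: fh; rewrite [in X in X -> _](near_shift 0) => fh.
  near=> y => /=.
  have fhy : f (y + x) = h (y + x).
    by near: y; apply: filterS fh => z /=; rewrite subr0.
  have -> : (h \o +%R^~ x - (cst (f x) + 'd f x)) y =
      (f \o +%R^~ x - (cst (f x) + 'd f x)) y; last by [].
  by rewrite !fctE /= fhy.
have dh := diff_unique (diff_continuous df) hE.
by apply/diff_locallyP; rewrite dh; split=> //; exact: diff_continuous.
Unshelve. all: by end_near. Qed.

End NearDifferentiable.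

(** * Smooth functions on R^8 minus the origin *)

Section PuncturedSpace.
Context {R : realType}.
Local Notation E := (R8 R).

Lemma near_neq0 (x : E) : x != 0 -> \forall y \near x, y != 0.
Proof.
move=> x0; apply: open_nbhs_nbhs; split => //.
rewrite (_ : (fun y : E => is_true (y != 0)) = ~` [set 0])%classic.
  apply/closed_openC/accessible_closed_set1/hausdorff_accessible/norm_hausdorff.
by apply/funext => y /=; apply/propext; split=> /eqP.
Qed.

(** [Ck 0] is already differentiability: all derivatives of order at most [n] are differentiable.
    The recursion strips the innermost derivative, which suits induction by the product rule. *)
Fixpoint Ck (V : normedModType R) (n : nat) (F : E -> V) : Prop :=
  (forall x, x != 0 -> differentiable F x) /\
  (if n is n'.+1 then forall v, Ck n' ('D_v F) else True).

Definition Cinf (V : normedModType R) (F : E -> V) := forall n, Ck n F.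

Lemma Ck_diff (V : normedModType R) n (F : E -> V) :
  Ck n F -> forall x, x != 0 -> differentiable F x.
Proof. by case: n => [|n] []. Qed.

Lemma CkS (V : normedModType R) n (F : E -> V) : Ck n.+1 F -> Ck n F.
Proof.
elim: n F => [|n IH] F [dF cF] //; split=> // v.
exact: IH (cF v).
Qed.

Lemma eq_derive_neq0 (V : normedModType R) (F G : E -> V) v x :
  (forall x, x != 0 -> F x = G x) -> x != 0 -> 'D_v F x = 'D_v G x.
Proof.
move=> FG x0; apply: near_eq_derive.
by near=> y; apply: FG; near: y; exact: near_neq0.
Unshelve. all: by end_near. Qed.

Lemma eq_Ck (V : normedModType R) n (F G : E -> V) :
  (forall x, x != 0 -> F x = G x) -> Ck n F -> Ck n G.
Proof.
have dE (F' G' : E -> V) : (forall x, x != 0 -> F' x = G' x) ->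
    (forall x, x != 0 -> differentiable F' x) ->
    forall x, x != 0 -> differentiable G' x.
  move=> FG dF x x0; apply: near_eq_differentiable (dF x x0).
  by near=> y; apply: FG; near: y; exact: near_neq0.
elim: n F G => [|n IH] F G FG [dF cF]; split=> //; try exact: dE dF.
by move=> v; apply: IH (cF v) => x x0; exact: eq_derive_neq0.
Unshelve. all: by end_near. Qed.

Lemma Cinf_derive (V : normedModType R) (F : E -> V) v :
  Cinf F -> Cinf ('D_v F).
Proof. by move=> cF n; have [_] := cF n.+1; apply. Qed.

Lemma Cinf_diff (V : normedModType R) (F : E -> V) x :
  Cinf F -> x != 0 -> differentiable F x.
Proof. by move=> /(_ 0%N)/Ck_diff; exact. Qed.

(** [iter_derive] stacks derivatives on the outside and [Ck] on the inside, hence the induction from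
    the end of the list. *)
Lemma smoothP (V : normedModType R) (f : S7 R -> V) :
  smooth f <-> Cinf (radext f).
Proof.
have rc (vs : seq E) v (F : E -> V) :
    iter_derive (rcons vs v) F = iter_derive vs ('D_v F).
  by rewrite /iter_derive foldr_rcons.
rewrite /smooth; move: (radext f) => F; split=> [sF n|cF vs x x0].
  elim: n F sF => [|n IH] F sF; split=> //; try exact: (sF [::]).
  by move=> v; apply: IH => vs x x0; rewrite -rc; exact: sF.
elim/last_ind: vs F cF => [|vs v IH] F cF; first exact: Cinf_diff.
by rewrite rc; exact/IH/Cinf_derive.
Qed.

Lemma Ck_cst (V : normedModType R) n (c : V) : Ck n (fun _ => c).
Proof.
elim: n c => [|n IH] c; split=> //; try by move=> x _; exact: differentiable_cst.
move=> v.
rewrite (_ : 'D_v _ = fun _ => 0); first exact: IH.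
by apply/funext => x; rewrite derive_cst.
Qed.

Lemma Ck_add (V : normedModType R) n (F G : E -> V) :
  Ck n F -> Ck n G -> Ck n (fun x => F x + G x).
Proof.
elim: n F G => [|n IH] F G [dF cF] [dG cG]; split=> //.
- by move=> x x0; apply: differentiableD; [exact: dF|exact: dG].
- by move=> x x0; apply: differentiableD; [exact: dF|exact: dG].
move=> v; apply: eq_Ck (IH _ _ (cF v) (cG v)) => x x0.
by rewrite [RHS]deriveD //; apply: diff_derivable; [exact: dF|exact: dG].
Qed.

Lemma Ck_mul n (f h : E -> R^o) :
  Ck n f -> Ck n h -> Ck n ((fun x => f x * h x) : E -> R^o).
Proof.
elim: n f h => [|n IH] f h cf ch.
  by split=> // x x0; apply: differentiableM;
    [exact: Ck_diff cf _ x0|exact: Ck_diff ch _ x0].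
split.
  by move=> x x0; apply: differentiableM;
    [exact: Ck_diff cf _ x0|exact: Ck_diff ch _ x0].
move=> v; have [df cf'] := cf; have [dh ch'] := ch.
apply: eq_Ck (Ck_add (IH _ _ (CkS cf) (ch' v)) (IH _ _ (CkS ch) (cf' v))).
move=> x x0; rewrite [RHS]deriveM //; apply: diff_derivable; [exact: df|exact: dh].
Qed.

Lemma derive_scalel (V : normedModType R) (f : E -> R^o) (c : V) x v :
  differentiable f x -> 'D_v (fun x => f x *: c) x = 'D_v f x *: c.
Proof.
move=> df; rewrite deriveE; last exact: differentiableZl.
by rewrite diffZl // deriveE.
Qed.

Lemma Ck_scalel (V : normedModType R) n (f : E -> R^o) (c : V) :
  Ck n f -> Ck n (fun x => f x *: c).
Proof.
elim: n f => [|n IH] f [df cf]; split=> //.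
- by move=> x x0; exact/differentiableZl/df.
- by move=> x x0; exact/differentiableZl/df.
move=> v; apply: eq_Ck (IH _ (cf v)) => x x0.
by rewrite derive_scalel //; exact: df.
Qed.

Lemma Ck_sum (V : normedModType R) (I : Type) (s : seq I) n (F : I -> E -> V) :
  (forall i, Ck n (F i)) -> Ck n (fun x => \sum_(i <- s) F i x).
Proof.
move=> cF; elim: s => [|i s IH].
  by apply: eq_Ck (Ck_cst n 0) => x _; rewrite big_nil.
by apply: eq_Ck (Ck_add (cF i) IH) => x _; rewrite big_cons.
Qed.

Lemma derive_coord (F : E -> E) x v i :
  differentiable F x -> 'D_v (fun x => F x i 0 : R^o) x = ('D_v F x) i 0.
Proof. by move=> dF; rewrite derive_mx ?mxE //; exact: diff_derivable. Qed.

Lemma col_basis (x : E) : x = \sum_(i < 8) x i 0 *: e_ i.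
Proof.
by rewrite [LHS]matrix_sum_delta; apply: eq_bigr => i _; rewrite big_ord1.
Qed.

(** Reduces vector-valued regularity to scalar functions, where the product rule [Ck_mul] is
    available. *)
Lemma Ck_colP n (F : E -> E) :
  Ck n F <-> forall i, Ck n (fun x => F x i 0 : R^o).
Proof.
split=> [cF i|cF]; last first.
  apply: eq_Ck (Ck_sum (index_enum _) (fun i => Ck_scalel (e_ i) (cF i))) => x _.
  by rewrite [RHS]col_basis.
have dc (G : E -> E) x :
    differentiable G x -> differentiable (fun x => G x i 0 : R^o) x.
  move=> dG; rewrite (_ : (fun x => _) = (fun N : E => N i 0 : R^o) \o G) //.
  by apply: differentiable_comp => //; exact: differentiable_coord.
elim: n F cF => [|n IH] F [dF cF]; split=> //; try by move=> x x0; exact/dc/dF.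
move=> v; apply: eq_Ck (IH _ (cF v)) => x x0.
by rewrite derive_coord //; exact: dF.
Qed.

Lemma Cinf_colP (F : E -> E) : Cinf F <-> forall i, Cinf (fun x => F x i 0 : R^o).
Proof.
split=> cF; last by move=> n; apply/Ck_colP => i; exact: cF.
by move=> i n; have [H _] := Ck_colP n F; exact: H (cF n) i.
Qed.

Lemma Ck_id n : Ck n (id : E -> E).
Proof.
case: n => [|n]; split=> //.
move=> v; apply: eq_Ck (Ck_cst n v) => x _.
by rewrite derive_id.
Qed.

End PuncturedSpace.

(** * The Euclidean inner product *)

Section DotAlgebra.
Context {R : realType}.
Local Notation E := (R8 R).
Implicit Types (x y z : E) (a : R).

Lemma dotDl x y z : dot (x + y) z = dot x z + dot y z.
Proof. by have := dotP 1 x y z; rewrite scale1r mul1r. Qed.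

Lemma dot0l x : dot 0 x = 0.
Proof. by rewrite /dot big1 // => i _; rewrite mxE mul0r. Qed.

Lemma dotZl a x z : dot (a *: x) z = a * dot x z.
Proof. by rewrite -[a *: x]addr0 dotP dot0l addr0. Qed.

Lemma dotDr x y z : dot z (x + y) = dot z x + dot z y.
Proof. by rewrite dotC dotDl !(dotC z). Qed.

Lemma dotZr a x z : dot z (a *: x) = a * dot z x.
Proof. by rewrite dotC dotZl (dotC z). Qed.

Lemma dotNl x z : dot (- x) z = - dot x z.
Proof. by rewrite -scaleN1r dotZl mulN1r. Qed.

Lemma dotNr x z : dot z (- x) = - dot z x.
Proof. by rewrite dotC dotNl dotC. Qed.

Lemma dotBl x y z : dot (x - y) z = dot x z - dot y z.
Proof. by rewrite dotDl dotNl. Qed.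

Lemma dotBr x y z : dot z (x - y) = dot z x - dot z y.
Proof. by rewrite dotDr dotNr. Qed.

Lemma dot_suml (I : Type) (s : seq I) (F : I -> E) z :
  dot (\sum_(i <- s) F i) z = \sum_(i <- s) dot (F i) z.
Proof. exact: (big_morph (fun x => dot x z) (fun x y => dotDl x y z) (dot0l z)). Qed.

Lemma dotxx_ge0 x : 0 <= dot x x.
Proof. by apply: sumr_ge0 => i _; rewrite -expr2 sqr_ge0. Qed.

Lemma dotxx_eq0 x : (dot x x == 0) = (x == 0).
Proof.
apply/idP/eqP => [|->]; last by rewrite dot0l.
rewrite psumr_eq0 => [|i _]; last by rewrite -expr2 sqr_ge0.
move=> /allP x0; apply/colP => i; rewrite mxE.
by have := x0 i (mem_index_enum i); rewrite -expr2 sqrf_eq0 => /eqP.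
Qed.

Lemma dotxx_gt0 x : x != 0 -> 0 < dot x x.
Proof. by move=> x0; rewrite lt_def dotxx_eq0 x0 dotxx_ge0. Qed.

Lemma dot_valP (p : S7 R) : dot (val p) (val p) = 1.
Proof. exact/eqP/(valP p). Qed.

Lemma val_neq0 (p : S7 R) : val p != 0.
Proof. by rewrite -dotxx_eq0 dot_valP oner_eq0. Qed.

Lemma parseval x y : \sum_(i < 8) dot x (e_ i) * dot (e_ i) y = dot x y.
Proof. by apply: eq_bigr => i _; rewrite (dotC _ y) !dot_delta. Qed.

Lemma eq_dot x y : (forall z, dot x z = dot y z) -> x = y.
Proof.
move=> xy; apply/eqP; rewrite -subr_eq0 -dotxx_eq0; apply/eqP.
by rewrite dotBl xy subrr.
Qed.

Lemma eq_tangent (p : S7 R) x y : tangent p x -> tangent p y ->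
  (forall z, tangent p z -> dot x z = dot y z) -> x = y.
Proof.
move=> px py xy; apply/eqP; rewrite -subr_eq0 -dotxx_eq0; apply/eqP.
have pd : tangent p (x - y) by rewrite /tangent dotBl px py subrr.
by rewrite {1}[x - y]/(x - y) dotBl xy // subrr.
Qed.

End DotAlgebra.

(** * Differentiating products, linear maps and the inverse norm *)

Section PuncturedCalculus.
Context {R : realType}.
Local Notation E := (R8 R).

Lemma differentiable_scalarP (F : E -> E) x :
  differentiable F x -> forall i, differentiable (fun x => F x i 0 : R^o) x.
Proof.
move=> dG i; rewrite (_ : (fun x => _) = (fun N : E => N i 0 : R^o) \o F) //.
by apply: differentiable_comp => //; exact: differentiable_coord.
Qed.

Lemma dot_fctE (F G : E -> E) :
  (fun x => dot (F x) (G x) : R^o) =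
  \sum_(i < 8) ((fun x => F x i 0 : R^o) * (fun x => G x i 0 : R^o) : E -> R^o).
Proof. by apply/funext => x; rewrite fct_sumE. Qed.

Lemma differentiable_dot (F G : E -> E) x :
  differentiable F x -> differentiable G x ->
  differentiable (fun x => dot (F x) (G x) : R^o) x.
Proof.
move=> dF dG; rewrite dot_fctE; apply: differentiable_sum => i.
by apply: differentiableM; exact: differentiable_scalarP.
Qed.

Lemma derive_dot (F G : E -> E) x v :
  differentiable F x -> differentiable G x ->
  'D_v (fun x => dot (F x) (G x) : R^o) x =
  dot ('D_v F x) (G x) + dot (F x) ('D_v G x).
Proof.
move=> dF dG; have dFi := differentiable_scalarP dF.
have dGi := differentiable_scalarP dG.
rewrite dot_fctE derive_sum => [|i]; last first.
  by apply: diff_derivable; exact: differentiableM.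
rewrite /dot -big_split; apply: eq_bigr => i _ /=.
rewrite deriveM; try exact: diff_derivable.
rewrite !derive_coord // addrC; congr (_ + _).
by rewrite -[LHS]/(_ * _) mulrC.
Qed.

Lemma derive_scale (f : E -> R^o) (F : E -> E) x v :
  differentiable f x -> differentiable F x ->
  'D_v (fun x => f x *: F x) x = 'D_v f x *: F x + f x *: 'D_v F x.
Proof.
move=> df dF; have dFi := differentiable_scalarP dF.
have -> : (fun x => f x *: F x) =
    \sum_(i < 8) (fun x => (f * (fun x => F x i 0 : R^o) : E -> R^o) x *: e_ i).
  apply/funext => y; rewrite fct_sumE {1}[F y]col_basis scaler_sumr.
  by apply: eq_bigr => i _; rewrite scalerA.
have dfi i : differentiable (f * (fun x => F x i 0 : R^o) : E -> R^o) x.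
  exact: differentiableM.
rewrite derive_sum => [|i]; last exact/diff_derivable/differentiableZl.
rewrite [in RHS](col_basis (F x)) [in RHS](col_basis ('D_v F x)) !scaler_sumr.
rewrite -big_split; apply: eq_bigr => i _ /=.
rewrite derive_scalel // deriveM; try exact: diff_derivable.
rewrite derive_coord // !scalerA -scalerDl addrC; congr ((_ + _) *: _).
by rewrite -[LHS]/(_ * _) mulrC.
Qed.

Lemma Ck_dot n (F G : E -> E) :
  Ck n F -> Ck n G -> Ck n (fun x => dot (F x) (G x) : R^o).
Proof.
move=> /Ck_colP cF /Ck_colP cG.
by apply: Ck_sum => i; apply: Ck_mul; [exact: cF|exact: cG].
Qed.

Lemma Ck_scale n (f : E -> R^o) (F : E -> E) :
  Ck n f -> Ck n F -> Ck n (fun x => f x *: F x).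
Proof.
move=> cf /Ck_colP cF; apply/Ck_colP => i.
by apply: eq_Ck (Ck_mul cf (cF i)) => x _; rewrite mxE.
Qed.

Definition real_linear (L : E -> E) := forall a x y, L (a *: x + y) = a *: L x + L y.

Section Lin.
Context {L : E -> E} (linL : real_linear L).
Let pL := GRing.isLinear.Build _ _ _ _ L linL.
Let LL : {linear E -> E} := HB.pack L pL.

Lemma linD x y : L (x + y) = L x + L y. Proof. exact: (linearD LL). Qed.
Lemma linZ a x : L (a *: x) = a *: L x. Proof. exact: (linearZ_LR LL). Qed.
Lemma linB x y : L (x - y) = L x - L y. Proof. exact: (linearB LL). Qed.
Lemma linN x : L (- x) = - L x. Proof. exact: (linearN LL). Qed.
Lemma lin0 : L 0 = 0. Proof. exact: (linear0 LL). Qed.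
Lemma lin_sum (I : Type) (s : seq I) (F : I -> E) :
  L (\sum_(i <- s) F i) = \sum_(i <- s) L (F i).
Proof. exact: (linear_sum LL). Qed.

Lemma lin_basis x : L x = \sum_(i < 8) x i 0 *: L (e_ i).
Proof. by rewrite {1}[x]col_basis lin_sum; apply: eq_bigr => i _; rewrite linZ. Qed.

Lemma Ck_lin n (F : E -> E) : Ck n F -> Ck n (fun x => L (F x)).
Proof.
move=> /Ck_colP cF; apply: eq_Ck (Ck_sum (index_enum _) (fun i =>
  Ck_scalel (L (e_ i)) (cF i))) => x _.
by rewrite [RHS]lin_basis.
Qed.

Lemma lin_fctE (F : E -> E) :
  (fun x => L (F x)) =
  \sum_(i < 8) (fun x => (F x i 0 : R^o) *: L (e_ i)).
Proof. by apply/funext => x; rewrite fct_sumE lin_basis. Qed.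

Lemma differentiable_lin (F : E -> E) x :
  differentiable F x -> differentiable (fun x => L (F x)) x.
Proof.
move=> dF; rewrite lin_fctE; apply: differentiable_sum => i.
exact/differentiableZl/differentiable_scalarP.
Qed.

Lemma derive_lin (F : E -> E) x v :
  differentiable F x -> 'D_v (fun x => L (F x)) x = L ('D_v F x).
Proof.
move=> dF; have dFi := differentiable_scalarP dF; rewrite lin_fctE.
rewrite derive_sum => [|i]; last exact/diff_derivable/differentiableZl.
rewrite lin_basis; apply: eq_bigr => i _.
by rewrite derive_scalel // derive_coord.
Qed.

Lemma derive_comp_lin (V : normedModType R) (F : E -> V) x v :
  differentiable F (L x) -> 'D_v (fun x => F (L x)) x = 'D_(L v) F (L x).
Proof.
move=> dF; have did : differentiable (fun x : E => x) x by exact: ex_diff.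
have dL := differentiable_lin did.
rewrite deriveE; last exact: (differentiable_comp dL dF).
rewrite -[fun x => F (L x)]/(F \o L) diff_comp //= [RHS]deriveE //.
by have := derive_lin v did; rewrite deriveE // derive_id => ->.
Qed.

Lemma Ck_comp_lin (V : normedModType R) n (F : E -> V) :
  (forall x, x != 0 -> L x != 0) -> Ck n F -> Ck n (fun x => F (L x)).
Proof.
move=> L0; have dC (G : E -> V) : (forall x, x != 0 -> differentiable G x) ->
    forall x, x != 0 -> differentiable (fun x => G (L x)) x.
  move=> dG x x0; have did : differentiable (fun x : E => x) x by exact: ex_diff.
  exact: (differentiable_comp (differentiable_lin did) (dG _ (L0 _ x0))).
elim: n F => [|n IH] F [dF cF]; split=> //; try exact: dC.
move=> v; apply: eq_Ck (IH _ (cF (L v))) => x x0.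
by rewrite [RHS]derive_comp_lin //; exact/dF/L0.
Qed.

End Lin.

Definition invnorm (x : E) : R^o := (Num.sqrt (dot x x))^-1.

Lemma invnorm_gt0 x : x != 0 -> 0 < invnorm x.
Proof. by move=> x0; rewrite invr_gt0 sqrtr_gt0 dotxx_gt0. Qed.

(** The derivative $-|x|^{-3}\langle x,v\rangle$ is written in [invnorm] again, so that the
    induction in [Ck_invnorm] closes. *)
Lemma is_derive_invnorm (x : E) v : x != 0 ->
  differentiable invnorm x /\
  'D_v invnorm x = - (invnorm x * invnorm x * invnorm x) * dot x v.
Proof.
move=> x0; have n0 := dotxx_gt0 x0.
have did : differentiable (fun x : E => x) x by exact: ex_diff.
have dd := differentiable_dot did did.
pose s (t : R) : R^o := (Num.sqrt t)^-1.
have sq0 : Num.sqrt (dot x x) != 0 by rewrite gt_eqF // sqrtr_gt0.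
have := is_derive1_sqrt n0 => /(is_deriveV (f := Num.sqrt) sq0) ds.
have dS : differentiable s (dot x x) by apply/derivable1_diffP; case: ds.
split; first exact: (differentiable_comp dd dS).
rewrite deriveE; last exact: (differentiable_comp dd dS).
rewrite -[invnorm]/(s \o (fun x => dot x x : R^o)) diff_comp //=.
rewrite diff1E // -deriveE // derive_dot // derive_id derive1E.
have -> : 'D_1 s (dot x x) = - (Num.sqrt (dot x x)) ^- 2 *: (2 * Num.sqrt (dot x x))^-1.
  by case: ds.
rewrite /s (dotC v) -[LHS]/(_ * _) -[X in _ * X]/(_ * _).
by field.
Qed.

Lemma Ck_invnorm n : Ck n invnorm.
Proof.
elim: n => [|n IH]; split=> //; try by move=> x x0; case: (is_derive_invnorm 0 x0).
move=> v.
have cd : Ck n (fun x : E => dot x v : R^o) by exact/Ck_dot/Ck_cst/Ck_id.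
apply: eq_Ck (Ck_mul (Ck_mul (Ck_cst n (-1 : R^o)) (Ck_mul (Ck_mul IH IH) IH)) cd).
by move=> x x0; case: (is_derive_invnorm v x0) => _ ->; rewrite mulN1r.
Qed.

End PuncturedCalculus.

(** * Differentiation on the sphere *)

Section SphereCalculus.
Context {R : realType}.
Local Notation E := (R8 R).
Local Notation S7 := (S7 R).

Lemma val_normalize (x : E) : x != 0 -> val (normalize x) = invnorm x *: x.
Proof.
move=> x0; rewrite /normalize val_insubd ifT // dotZl dotZr mulrA -expr2.
by rewrite exprVn sqr_sqrtr ?dotxx_ge0 // mulVf // dotxx_eq0.
Qed.

Lemma invnorm_val (p : S7) : invnorm (val p) = 1.
Proof. by rewrite /invnorm dot_valP sqrtr1 invr1. Qed.

Lemma normalize_val (p : S7) : normalize (val p) = p.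
Proof. by apply: val_inj; rewrite val_normalize ?val_neq0 // invnorm_val scale1r. Qed.

Lemma normalizeZ (c : R) (x : E) : 0 < c -> normalize (c *: x) = normalize x.
Proof.
move=> c0; rewrite /normalize; congr insubd.
rewrite dotZl dotZr mulrA -expr2 sqrtrM ?sqr_ge0 // sqrtr_sqr gtr0_norm //.
by rewrite scalerA invfM mulrAC mulVf ?mul1r // gt_eqF.
Qed.

Lemma radext_at (V : Type) (f : S7 -> V) (p : S7) : radext f (val p) = f p.
Proof. by rewrite /radext normalize_val. Qed.

Lemma radext_differentiable (V : normedModType R) (f : S7 -> V) x :
  smooth f -> x != 0 -> differentiable (radext f) x.
Proof. by move=> /smoothP sf; exact: Cinf_diff. Qed.

Lemma smooth_differentiable (V : normedModType R) (f : S7 -> V) (p : S7) :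
  smooth f -> differentiable (radext f) (val p).
Proof. by move=> sf; apply: radext_differentiable => //; exact: val_neq0. Qed.

Lemma smooth_cst (V : normedModType R) (c : V) : smooth (fun _ : S7 => c).
Proof. by apply/smoothP => n; exact: Ck_cst. Qed.

Lemma smoothD (V : normedModType R) (f h : S7 -> V) :
  smooth f -> smooth h -> smooth (fun p => f p + h p).
Proof. by move=> /smoothP cf /smoothP ch; apply/smoothP => n; exact: Ck_add. Qed.

Lemma smoothM (f h : S7 -> R) : smooth (f : S7 -> R^o) -> smooth (h : S7 -> R^o) ->
  smooth ((fun p => f p * h p) : S7 -> R^o).
Proof. by move=> /smoothP cf /smoothP ch; apply/smoothP => n; exact: Ck_mul. Qed.

Lemma smoothN1 (f : S7 -> R) : smooth (f : S7 -> R^o) ->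
  smooth ((fun p => - f p) : S7 -> R^o).
Proof.
move=> sf; rewrite (_ : (fun p => _) = (fun p => (-1) * f p)).
  by apply: smoothM => //; exact: smooth_cst.
by apply/funext => p; rewrite mulN1r.
Qed.

Lemma smooth_scale (f : S7 -> R) (F : S7 -> E) :
  smooth (f : S7 -> R^o) -> smooth F -> smooth (fun p => f p *: F p).
Proof.
move=> /smoothP cf /smoothP cF; apply/smoothP => n.
exact: (Ck_scale (cf n) (cF n)).
Qed.

Lemma smooth_dot (F G : S7 -> E) : smooth F -> smooth G ->
  smooth ((fun p => dot (F p) (G p)) : S7 -> R^o).
Proof. by move=> /smoothP cf /smoothP ch; apply/smoothP => n; exact: Ck_dot. Qed.

Lemma smooth_lin (L : E -> E) (F : S7 -> E) :
  real_linear L -> smooth F -> smooth (fun p => L (F p)).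
Proof. by move=> linL /smoothP cf; apply/smoothP => n; exact: (Ck_lin linL). Qed.

Lemma smoothN (F : S7 -> E) : smooth F -> smooth (fun p => - F p).
Proof. by apply: (smooth_lin (L := -%R)) => a x y; rewrite opprD scalerN. Qed.

Lemma smoothB (F G : S7 -> E) : smooth F -> smooth G -> smooth (fun p => F p - G p).
Proof. by move=> sF sG; apply: smoothD => //; exact: smoothN. Qed.

Lemma smooth_val : smooth (val : S7 -> E).
Proof.
apply/smoothP => n.
apply: eq_Ck (Ck_scale (Ck_invnorm n) (Ck_id n)) => x x0.
by rewrite /radext val_normalize.
Qed.

(** [deriv_along X f p] is [deriv_at p (X p) f] by conversion; detaching the vector from a field
    makes linearity in it expressible. *)
Definition deriv_at (V : normedModType R) (p : S7) (v : E) (f : S7 -> V) : V :=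
  'D_v (radext f) (val p).

Lemma deriv_at_linear (V : normedModType R) p a v w (f : S7 -> V) : smooth f ->
  deriv_at p (a *: v + w) f = a *: deriv_at p v f + deriv_at p w f.
Proof.
move=> sf; have df := smooth_differentiable p sf.
by rewrite /deriv_at !deriveE // linearP.
Qed.

Lemma deriv_at_cst (V : normedModType R) p v (c : V) : deriv_at p v (fun _ => c) = 0.
Proof. exact: derive_cst. Qed.

Lemma deriv_atD (V : normedModType R) p v (f h : S7 -> V) : smooth f -> smooth h ->
  deriv_at p v (fun p => f p + h p) = deriv_at p v f + deriv_at p v h.
Proof.
move=> sf sh; rewrite /deriv_at -[radext _]/(radext f + radext h) deriveD //.
  exact/diff_derivable/smooth_differentiable.
exact/diff_derivable/smooth_differentiable.
Qed.

Lemma deriv_at_lin (L : E -> E) p v (F : S7 -> E) : real_linear L -> smooth F ->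
  deriv_at p v (fun p => L (F p)) = L (deriv_at p v F).
Proof. by move=> linL sF; apply: derive_lin => //; exact: smooth_differentiable. Qed.

Lemma deriv_atN p v (F : S7 -> E) : smooth F ->
  deriv_at p v (fun p => - F p) = - deriv_at p v F.
Proof. by apply: (@deriv_at_lin -%R) => a x y; rewrite opprD scalerN. Qed.

Lemma deriv_at_dot p v (F G : S7 -> E) : smooth F -> smooth G ->
  deriv_at p v ((fun p => dot (F p) (G p)) : S7 -> R^o) =
  dot (deriv_at p v F) (G p) + dot (F p) (deriv_at p v G).
Proof.
move=> sF sG; rewrite /deriv_at -[radext _]/((fun x => dot (radext F x) (radext G x))).
by rewrite derive_dot ?radext_at //; exact: smooth_differentiable.
Qed.

Lemma deriv_at_scale p v (f : S7 -> R^o) (F : S7 -> E) : smooth f -> smooth F ->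
  deriv_at p v (fun p => f p *: F p) = deriv_at p v f *: F p + f p *: deriv_at p v F.
Proof.
move=> sf sF; rewrite /deriv_at -[radext _]/(fun x => radext f x *: radext F x).
by rewrite derive_scale ?radext_at //; exact: smooth_differentiable.
Qed.

(** The extension of [val] is $x/|x|$, whose differential at a unit vector is the projection off the
    normal line. *)
Lemma deriv_at_val p v : tangent p v -> deriv_at p v val = v.
Proof.
move=> pv; rewrite /deriv_at; have p0 := val_neq0 p.
pose F (x : E) := invnorm x *: x.
rewrite (@eq_derive_neq0 _ _ _ F) //; last first.
  by move=> x x0; rewrite /radext val_normalize.
have [di Di] := is_derive_invnorm v p0.
have cF n : Ck n F by exact: (Ck_scale (Ck_invnorm n) (Ck_id n)).
have dF : differentiable F (val p) by exact: Ck_diff (cF 0%N) _ p0.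
apply/colP => i; rewrite -derive_coord //.
have -> : (fun x => F x i 0 : R^o) = (invnorm : E -> R^o) * (fun x : E => x i 0 : R^o).
  by apply/funext => x; rewrite /F mxE.
have did : differentiable (fun x : E => x) (val p) by exact: ex_diff.
have dc : differentiable (fun x : E => x i 0 : R^o) (val p).
  exact: differentiable_coord.
rewrite deriveM; try exact/diff_derivable.
rewrite Di (derive_coord v i did) derive_id invnorm_val dotC pv mulr0 scaler0 addr0.
exact: mul1r.
Qed.

End SphereCalculus.

(** * Symmetry of second derivatives *)

Section Schwarz.
Local Open Scope classical_set_scope.
Local Open Scope ring_scope.
Context {R : realType} {V : normedModType R}.

Lemma is_derive_line (f : V -> R^o) b w (t : R) : differentiable f (b + t *: w) ->
  is_derive t 1 (fun t : R => f (b + t *: w)) ('D_w f (b + t *: w)).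
Proof.
move=> df.
have did : differentiable (fun t : R => t : R^o) t by exact: ex_diff.
have dw : differentiable (fun t : R => t *: w) t by exact: differentiableZl.
have db : differentiable (cst b) t by exact: differentiable_cst.
have dl : differentiable (cst b + (fun t : R => t *: w)) t.
  exact: differentiableD.
have dc : differentiable (f \o (cst b + (fun t : R => t *: w))) t.
  exact: differentiable_comp.
split; first exact: diff_derivable.
rewrite deriveE // (diff_comp dl) //= [RHS]deriveE //; congr ('d f _ _).
rewrite diffD // diff_cst /= add0r diffZl //.
by rewrite (diff_val (f := id)) scale1r.
Qed.

(** Two mean value theorems: one along [u] for the increment $f(\cdot+hv)-f$, then one along [v] for
    ['D_u f]. *)
Lemma second_difference (f : V -> R^o) (a u v : V) (h : R) : 0 < h ->
  (forall s t, 0 <= s <= h -> 0 <= t <= h ->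
     differentiable f (a + s *: u + t *: v) /\
     differentiable ('D_u f) (a + s *: u + t *: v)) ->
  exists s t, [/\ 0 <= s <= h, 0 <= t <= h &
    f (a + h *: u + h *: v) - f (a + h *: u) - (f (a + h *: v) - f a) =
    h ^+ 2 * 'D_v ('D_u f) (a + s *: u + t *: v)].
Proof.
move=> h0 df; have hh : 0 <= h <= h by rewrite lexx ltW.
have h00 : 0 <= (0 : R) <= h by rewrite lexx ltW.
have itvP (s : R) : s \in `]0, h[ -> 0 <= s <= h.
  by rewrite in_itv /= => /andP[/ltW -> /ltW ->].
pose phi (s : R) := f ((a + h *: v) + s *: u) - f (a + s *: u).
have dphi (s : R) : 0 <= s <= h ->
    is_derive s 1 phi ('D_u f (a + s *: u + h *: v) - 'D_u f (a + s *: u)).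
  move=> sh; have [d1 _] := df s h sh hh; have [d2 _] := df s 0 sh h00.
  apply: is_deriveB.
    by rewrite addrAC; apply: is_derive_line; rewrite addrAC.
  by apply: is_derive_line; rewrite scale0r addr0 in d2.
have cphi : {within `[0, h], continuous phi}.
  apply: derivable_within_continuous => s; rewrite in_itv /= => sh.
  by case: (dphi s sh).
have [s /itvP sh /= E1] := MVT h0 (fun s sh => dphi s (itvP s sh)) cphi.
pose psi (t : R) := 'D_u f ((a + s *: u) + t *: v).
have dpsi (t : R) : 0 <= t <= h ->
    is_derive t 1 psi ('D_v ('D_u f) (a + s *: u + t *: v)).
  by move=> th; apply: is_derive_line; case: (df s t sh th).
have cpsi : {within `[0, h], continuous psi}.
  apply: derivable_within_continuous => t; rewrite in_itv /= => th.
  by case: (dpsi t th).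
have [t /itvP th /= E2] := MVT h0 (fun s sh => dpsi s (itvP s sh)) cpsi.
exists s, t; split => //.
move: E1; rewrite /phi scale0r !addr0 subr0 (addrAC a (h *: v)) => ->.
move: E2; rewrite /psi scale0r !addr0 subr0 => ->.
by ring.
Qed.

(** $D(h)/h^2$ is a value of [c1] and a value of [c2] at points tending to [a]. Continuity then
    excludes a gap between [c1 a] and [c2 a]; half the gap serves as tolerance. *)
Lemma eq_second_difference (D : R -> R) (c1 c2 : V -> R^o) (a u v : V) (r : R) :
  0 < r -> {for a, continuous c1} -> {for a, continuous c2} ->
  (forall h, 0 < h -> h * (2 * (`|u| + `|v| + 1)) <= r ->
    (exists s t, [/\ 0 <= s <= h, 0 <= t <= h &
       D h = h ^+ 2 * c1 (a + s *: u + t *: v)]) /\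
    (exists s t, [/\ 0 <= s <= h, 0 <= t <= h &
       D h = h ^+ 2 * c2 (a + s *: u + t *: v)])) ->
  c1 a = c2 a.
Proof.
move=> r0 cc1 cc2 HD; apply/eqP; rewrite -subr_eq0; apply/negP => /negP d0.
pose e := `|c1 a - c2 a| / 2.
have e0 : 0 < e by rewrite divr_gt0 // normr_gt0.
have [r' /= r'0 Hr] : exists2 r : R, 0 < r & forall x, `|x - a| < r ->
    `|c1 a - c1 x| < e /\ `|c2 a - c2 x| < e.
  move/cvgrPdist_lt : cc1 => /(_ e e0) cc1.
  move/cvgrPdist_lt : cc2 => /(_ e e0) cc2.
  have [r' /= r'0 Hr] := (nbhs_ballP a _).1 (@filterI _ (nbhs a) _ _ _ cc1 cc2).
  by exists r' => // x xa; apply: Hr; rewrite -ball_normE /= distrC.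
have n0 : 0 < `|u| + `|v| + 1 by rewrite ltr_wpDl // addr_ge0.
have n20 : 0 < 2 * (`|u| + `|v| + 1) by rewrite mulr_gt0.
(* The summand 1 keeps the denominator positive when [u] and [v] vanish. *)
pose h := Num.min r r' / (2 * (`|u| + `|v| + 1)).
have m0 : 0 < Num.min r r' by rewrite lt_min r0.
have h0 : 0 < h by rewrite divr_gt0.
have hr : h * (2 * (`|u| + `|v| + 1)) = Num.min r r' by rewrite divfK // gt_eqF.
have small s t : 0 <= s <= h -> 0 <= t <= h -> `|s *: u + t *: v| < r'.
  move=> /andP[s0 sh] /andP[t0 th]; apply: le_lt_trans (ler_normD _ _) _.
  rewrite !normrZ !ger0_norm //.
  apply: (@le_lt_trans _ _ (h * (`|u| + `|v|))).
    by rewrite mulrDr lerD // ler_wpM2r.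
  apply: (@lt_le_trans _ _ (h * (2 * (`|u| + `|v| + 1)))).
    rewrite ltr_pM2l //.
    have : 0 <= `|u| + `|v| by rewrite addr_ge0.
    by move: (`|u| + `|v|) => k k0; lra.
  by rewrite hr ge_min lexx orbT.
have [|[s [t [sh th E1]]] [s' [t' [sh' th' E2]]]] := HD h h0.
  by rewrite hr ge_min lexx.
move: E2; rewrite E1 => /(mulfI (lt0r_neq0 (exprn_gt0 2 h0))).
have near s1 t1 : 0 <= s1 <= h -> 0 <= t1 <= h -> `|a + s1 *: u + t1 *: v - a| < r'.
  by by move=> ? ?; rewrite addrAC (addrAC a) subrr add0r; exact: small.
have [H1 _] := Hr _ (near s t sh th).
have [_ H2] := Hr _ (near s' t' sh' th').
move: (c1 (_ + _)) (c2 (_ + _)) H1 H2 => y1 y2 H1 H2 E.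
have : `|c1 a - c2 a| < e + e.
  rewrite (_ : c1 a - c2 a = (c1 a - y1) - (c2 a - y2)); last by rewrite E; ring.
  by apply: le_lt_trans (ler_normB _ _) _; rewrite ltrD.
by rewrite -splitr ltxx.
Qed.

(** The second difference over the parallelogram on $hu$ and $hv$ is symmetric in [u] and [v], so it
    is a value of either mixed derivative times $h^2$. *)
Lemma schwarz (f : V -> R^o) (a u v : V) :
  (\forall x \near a, differentiable f x) ->
  (\forall x \near a, differentiable ('D_u f) x) ->
  (\forall x \near a, differentiable ('D_v f) x) ->
  {for a, continuous ('D_v ('D_u f))} -> {for a, continuous ('D_u ('D_v f))} ->
  'D_v ('D_u f) a = 'D_u ('D_v f) a.
Proof.
move=> df du dw cvu cuv.
have [r /= r0 Hr] := (nbhs_ballP a _).1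
  (@filterI _ (nbhs a) _ _ _ df (@filterI _ (nbhs a) _ _ _ du dw)).
apply: (@eq_second_difference (fun h => f (a + h *: u + h *: v) - f (a + h *: u) -
  (f (a + h *: v) - f a)) _ _ a u v r r0 cvu cuv) => h h0 hr.
have small s t : 0 <= s <= h -> 0 <= t <= h -> ball a r (a + s *: u + t *: v).
  move=> /andP[s0 sh] /andP[t0 th];
    rewrite -ball_normE /= opprD addrA opprD addrA subrr add0r.
  rewrite -opprD normrN; apply: le_lt_trans (ler_normD _ _) _.
  rewrite !normrZ !ger0_norm //; apply: lt_le_trans hr.
  apply: (@le_lt_trans _ _ (h * (`|u| + `|v|))).
    by rewrite mulrDr lerD // ler_wpM2r.
  rewrite ltr_pM2l //; have : 0 <= `|u| + `|v| by rewrite addr_ge0.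
  by move: (`|u| + `|v|) => k k0; lra.
split.
  apply: second_difference => // s t sh th.
  by have [? []] := Hr _ (small s t sh th).
have [|t [s [th sh E]]] := @second_difference f a v u h h0.
  move=> t s th sh; rewrite (addrAC a).
  by have [? []] := Hr _ (small s t sh th).
exists s, t; split; [exact: sh|exact: th|].
have -> : a + s *: u + t *: v = a + t *: v + s *: u by exact: addrAC.
apply: etrans E.
have -> : a + h *: v + h *: u = a + h *: u + h *: v by exact: addrAC.
by move: (f _) (f _) (f _) (f _) => f1 f2 f3 f4; ring.
Qed.

End Schwarz.

(** * Iterated derivatives along vector fields and the Lie bracket *)

Section SecondDerivatives.
Context {R : realType}.
Local Notation E := (R8 R).
Local Notation S7 := (S7 R).

Lemma derive_basis (V : normedModType R) (F : E -> V) x w : differentiable F x ->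
  'D_w F x = \sum_(i < 8) w i 0 *: 'D_(e_ i) F x.
Proof.
move=> dF; rewrite deriveE // {1}[w]col_basis linear_sum.
by apply: eq_bigr => i _; rewrite linearZ /= deriveE.
Qed.

Lemma schwarz_scalar (f : E -> R^o) a u v : Cinf f -> a != 0 ->
  'D_v ('D_u f) a = 'D_u ('D_v f) a.
Proof.
move=> cf a0; have near_diff (h : E -> R^o) : Cinf h ->
  \forall x \near a, differentiable h x.
  move=> ch; apply: filterS (near_neq0 a0) => x; exact: Cinf_diff.
have cu := Cinf_derive u cf; have cv := Cinf_derive v cf.
apply: schwarz; try exact: near_diff.
  exact/differentiable_continuous/Cinf_diff/a0/Cinf_derive.
exact/differentiable_continuous/Cinf_diff/a0/Cinf_derive.
Qed.

Lemma schwarz_vector (F : E -> E) a u v : Cinf F -> a != 0 ->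
  'D_v ('D_u F) a = 'D_u ('D_v F) a.
Proof.
move=> cF a0.
have coord u' v' i : ('D_v' ('D_u' F) a) i 0 = 'D_v' ('D_u' (fun x => F x i 0 : R^o)) a.
  rewrite -derive_coord; last exact/Cinf_diff/a0/Cinf_derive.
  apply: eq_derive_neq0 a0 => x x0.
  by rewrite derive_coord //; exact: Cinf_diff.
apply/colP => i; apply: etrans (coord u v i) _; apply: etrans (esym (coord v u i)).
apply: schwarz_scalar a0.
by have [+ _] := Cinf_colP F => /(_ cF).
Qed.

Lemma derive_radextZ (V : normedModType R) (f : S7 -> V) c x v :
  smooth f -> 0 < c -> x != 0 ->
  'D_v (radext f) (c *: x) = c^-1 *: 'D_v (radext f) x.
Proof.
move=> sf c0 x0; have cx0 : c *: x != 0 by rewrite scaler_eq0 negb_or gt_eqF.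
have linc : real_linear (fun x : E => c *: x).
  by move=> a y z; rewrite scalerDr !scalerA mulrC.
have df := radext_differentiable sf cx0.
have := derive_comp_lin linc v df.
have -> : (fun x => radext f (c *: x)) = radext f.
  by apply/funext => y; rewrite /radext normalizeZ.
by rewrite (deriveE (c *: v) df) linearZ /= -deriveE // => ->;
  rewrite scalerA mulVf ?scale1r // gt_eqF.
Qed.

(* [radext Z] is homogeneous of degree 0, so its differential has degree -1; the
   norm in [radext_deriv_along] compensates. *)
Definition frame_derive (Y Z : S7 -> E) (x : E) : E :=
  \sum_(i < 8) (radext Y x i 0 : R^o) *: 'D_(e_ i) (radext Z) x.

Lemma radext_deriv_along (Y Z : S7 -> E) x : smooth Z -> x != 0 ->
  radext (deriv_along Y Z) x = (dot x x * invnorm x) *: frame_derive Y Z x.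
Proof.
move=> sZ x0; rewrite /radext /deriv_along val_normalize //.
rewrite derive_radextZ ?invnorm_gt0 // derive_basis; last exact: radext_differentiable.
congr (_ *: _).
rewrite /invnorm invrK -[X in _ = X / _](sqr_sqrtr (dotxx_ge0 x)) expr2 mulfK //.
by rewrite gt_eqF // sqrtr_gt0 dotxx_gt0.
Qed.

(** The function is $|x|$, written as a product of factors already known to be smooth. *)
Lemma Ck_norm n : Ck n (fun x : E => dot x x * invnorm x : R^o).
Proof. exact: (Ck_mul (Ck_dot (Ck_id n) (Ck_id n)) (Ck_invnorm n)). Qed.

Lemma Ck_frame n (Y Z : S7 -> E) : smooth Y -> smooth Z -> Ck n (frame_derive Y Z).
Proof.
move=> /smoothP /Cinf_colP cY /smoothP cZ; apply: Ck_sum => i.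
by apply: Ck_scale; [exact: cY|exact: Cinf_derive].
Qed.

Lemma smooth_deriv_along (Y Z : S7 -> E) :
  smooth Y -> smooth Z -> smooth (deriv_along Y Z).
Proof.
move=> sY sZ; apply/smoothP => n.
apply: eq_Ck (Ck_scale (Ck_norm n) (Ck_frame n sY sZ)) => x x0.
by rewrite radext_deriv_along.
Qed.

(** This is why the correction factor $|x|$ leaves no trace in second derivatives on the sphere. *)
Lemma derive_norm (p : S7) v : tangent p v ->
  'D_v (fun x : E => dot x x * invnorm x : R^o) (val p) = 0.
Proof.
move=> pv; have p0 := val_neq0 p; have [di Di] := is_derive_invnorm v p0.
have did : differentiable (fun x : E => x) (val p) by exact: ex_diff.
have dd := differentiable_dot did did.
rewrite -[X in derive X]/((fun x : E => dot x x : R^o) * invnorm).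
rewrite deriveM; try exact: diff_derivable.
rewrite Di derive_dot // derive_id (dotC v) (dotC (val p) v) pv addr0.
by rewrite mulr0 !scaler0 addr0.
Qed.

(** Product rule: the first term differentiates the coefficients of [Y], the second is a flat second
    derivative of [Z] with [Y p] frozen. *)
Lemma deriv_at_deriv_along (p : S7) v (Y Z : S7 -> E) :
  smooth Y -> smooth Z -> tangent p v ->
  deriv_at p v (deriv_along Y Z) =
  deriv_at p (deriv_at p v Y) Z + 'D_v ('D_(Y p) (radext Z)) (val p).
Proof.
move=> sY sZ pv; have p0 := val_neq0 p.
have cY : Cinf (radext Y) by exact/smoothP.
have cZ : Cinf (radext Z) by exact/smoothP.
rewrite /deriv_at (eq_derive_neq0 _ (fun x => radext_deriv_along Y sZ (x := x))) //.
rewrite derive_scale; [|exact: Ck_diff (Ck_norm 0) _ p0|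
  exact: Ck_diff (Ck_frame 0 sY sZ) _ p0].
rewrite derive_norm // scale0r add0r dot_valP invnorm_val mulr1 scale1r.
have dYi := differentiable_scalarP (Cinf_diff cY p0).
have dZi i : differentiable ('D_(e_ i) (radext Z)) (val p).
  exact/Cinf_diff/p0/Cinf_derive.
have dYZ i : differentiable ((fun x => (radext Y x i 0 : R^o) *:
    'D_(e_ i) (radext Z) x)) (val p).
  by apply: Ck_diff p0; apply: (@Ck_scale _ 0) => //; [move/Cinf_colP: cY;
    exact | exact: Cinf_derive].
have -> : frame_derive Y Z = \sum_(i < 8) (fun x => (radext Y x i 0 : R^o) *:
    'D_(e_ i) (radext Z) x) by apply/funext => x; rewrite fct_sumE.
rewrite derive_sum => [|i]; last exact: diff_derivable.
rewrite (derive_basis _ (Cinf_diff cZ p0)).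
have -> : 'D_v ('D_(Y p) (radext Z)) (val p) =
   'D_v (\sum_(i < 8) (Y p i 0 *: ('D_(e_ i) (radext Z) : E -> E))) (val p).
  apply: eq_derive_neq0 p0 => x x0; rewrite fct_sumE.
  exact/derive_basis/Cinf_diff.
rewrite derive_sum => [|i]; last exact/derivableZ/diff_derivable.
rewrite -big_split; apply: eq_bigr => i _ /=; rewrite -[sval p]/(val p).
rewrite derive_scale // derive_coord; last exact: Cinf_diff cY p0.
by rewrite radext_at deriveZ //; exact: diff_derivable.
Qed.

(** The coefficient terms assemble to the bracket, and the flat second derivatives cancel by
    symmetry. *)
Lemma deriv_along_bracket (X Y Z : S7 -> E) p :
  smooth X -> smooth Y -> smooth Z -> tangent p (X p) -> tangent p (Y p) ->
  deriv_along X (deriv_along Y Z) p - deriv_along Y (deriv_along X Z) p =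
  deriv_along (lie_bracket X Y) Z p.
Proof.
move=> sX sY sZ pX pY.
rewrite -[deriv_along X _ p]/(deriv_at p (X p) _) -[deriv_along Y _ p]/(deriv_at p (Y
  p) _).
rewrite -[RHS]/(deriv_at p (deriv_at p (X p) Y - deriv_at p (Y p) X) Z).
rewrite !deriv_at_deriv_along //.
rewrite (_ : deriv_at p (X p) Y - _ = (-1) *: deriv_at p (Y p) X + deriv_at p (X p) Y);
  last first.
  by rewrite scaleN1r addrC.
rewrite deriv_at_linear // scaleN1r.
have cancel_second (a b c d : E) : c = d -> a + c - (b + d) = - b + a.
  by move=> ->; rewrite opprD addrACA subrr addr0 addrC.
by apply: cancel_second; apply: schwarz_vector; [exact/smoothP|exact: val_neq0].
Qed.

End SecondDerivatives.

(** * The Levi-Civita connection of the round metric *)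

Section VectorFields.
Context {R : realType}.
Local Notation E := (R8 R).
Local Notation S7 := (S7 R).
Implicit Types (p : S7) (X Y Z : S7 -> E).

Lemma tangentD p (x y : E) : tangent p x -> tangent p y -> tangent p (x + y).
Proof. by rewrite /tangent dotDl => -> ->; rewrite addr0. Qed.

Lemma tangentZ p a (x : E) : tangent p x -> tangent p (a *: x).
Proof. by rewrite /tangent dotZl => ->; rewrite mulr0. Qed.

Lemma tangentN p (x : E) : tangent p x -> tangent p (- x).
Proof. by rewrite /tangent dotNl => ->; rewrite oppr0. Qed.

Lemma tangentB p (x y : E) : tangent p x -> tangent p y -> tangent p (x - y).
Proof. by move=> px py; apply: tangentD => //; exact: tangentN. Qed.

Lemma smooth_ext (v : E) : smooth (ext v : S7 -> E).
Proof.
apply: smoothB; first exact: smooth_cst.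
apply: smooth_scale; last exact: smooth_val.
by apply: smooth_dot; [exact: smooth_cst|exact: smooth_val].
Qed.

Lemma vector_field_ext (v : E) : vector_field (ext v : S7 -> E).
Proof. by split; [exact: smooth_ext|move=> p; exact: tangent_tproj]. Qed.

Lemma vector_fieldD X Y : vector_field X -> vector_field Y ->
  vector_field (fun p => X p + Y p).
Proof.
by case=> sX tX [sY tY]; split; [exact: smoothD|move=> p; exact: tangentD].
Qed.

Lemma vector_field_scale (f : S7 -> R) X : smooth (f : S7 -> R^o) ->
  vector_field X -> vector_field (fun p => f p *: X p).
Proof.
by move=> sf [sX tX]; split; [exact: smooth_scale|move=> p; exact: tangentZ].
Qed.

(** Differentiate $\langle Y,q\rangle=0$ along [v]. *)
Lemma deriv_at_normal p v Y : vector_field Y -> tangent p v ->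
  dot (deriv_at p v Y) (val p) = - dot v (Y p).
Proof.
move=> [sY tY] pv; have := deriv_at_dot p v sY smooth_val.
have -> : (fun q => dot (Y q) (val q)) = fun _ => 0 by apply/funext => q; exact: tY.
rewrite deriv_at_cst deriv_at_val // => /esym/eqP.
by rewrite addr_eq0 (dotC (Y p)) => /eqP.
Qed.

Lemma deriv_at_ext p v w : tangent p v -> tangent p w ->
  deriv_at p w (ext v) = - dot v w *: val p.
Proof.
move=> pv pw.
have sv : smooth ((fun q : S7 => dot v (val q)) : S7 -> R^o).
  by apply: smooth_dot; [exact: smooth_cst|exact: smooth_val].
have sn : smooth (fun q : S7 => - (dot v (val q) *: val q)).
  by apply: smoothN; apply: smooth_scale => //; exact: smooth_val.
have -> : deriv_at p w (ext v) =
  deriv_at p w (fun q : S7 => v + - (dot v (val q) *: val q)) by [].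
rewrite deriv_atD //; last exact: smooth_cst.
rewrite deriv_at_cst add0r deriv_atN; last by apply: smooth_scale => //;
  exact: smooth_val.
rewrite (deriv_at_scale _ _ sv smooth_val) deriv_at_val // pv scale0r addr0.
rewrite (deriv_at_dot _ _ (smooth_cst v) smooth_val) deriv_at_cst dot0l add0r
  deriv_at_val //.
by rewrite scaleNr.
Qed.

Lemma vector_field_bracket X Y : vector_field X -> vector_field Y ->
  vector_field (lie_bracket X Y).
Proof.
move=> vX vY; have [sX tX] := vX; have [sY tY] := vY; split.
  by apply: smoothB; exact: smooth_deriv_along.
move=> p; rewrite /tangent dotBl.
by rewrite [X in X - _](deriv_at_normal vY (tX p)) [X in _
  - X](deriv_at_normal vX (tY p)) dotC subrr.
Qed.

Definition sphere_connection X Y : S7 -> E :=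
  fun p => deriv_along X Y p + dot (X p) (Y p) *: val p.

Lemma tangent_sphere_connection X Y p : vector_field X -> vector_field Y ->
  tangent p (sphere_connection X Y p).
Proof.
move=> [sX tX] vY; rewrite /tangent dotDl dotZl dot_valP mulr1.
by rewrite [X in X + _](deriv_at_normal vY (tX p)) addNr.
Qed.

Lemma dot_sphere_connection X Y p z : tangent p z ->
  dot (sphere_connection X Y p) z = dot (deriv_along X Y p) z.
Proof. by move=> pz; rewrite dotDl dotZl (dotC (val p)) pz mulr0 addr0. Qed.

(* Two metric torsion-free connections differ by a tensor symmetric in its
   first two slots and skew in the last two, hence zero. *)
Lemma levi_civita_sphere nablag X Y : levi_civita nablag ->
  vector_field X -> vector_field Y -> nablag X Y = sphere_connection X Y.
Proof.
move=> [[vN _] [mN tN]] vX vY; apply/funext => p.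
pose b X Y Z := dot (nablag X Y p - sphere_connection X Y p) (Z p).
have bsym X1 X2 X3 : vector_field X1 -> vector_field X2 -> b X1 X2 X3 = b X2 X1 X3.
  have cancel_torsion (u w d1 d2 c : E) :
      u - w - (d1 - d2) = 0 -> u - (d1 + c) = w - (d2 + c).
    move/eqP; rewrite subr_eq0 => /eqP E; apply/eqP.
    rewrite !opprD !addrA (inj_eq (addIr _)) subr_eq addrAC -addrA -E.
    by rewrite addrC subrK.
  move=> v1 v2; rewrite /b /sphere_connection (dotC (X1 p)).
  have E := tN X1 X2 v1 v2 p; rewrite /torsion /lie_bracket in E.
  by rewrite (cancel_torsion _ _ _ _ _ E).
have bskew X1 X2 X3 : vector_field X1 -> vector_field X2 -> vector_field X3 ->
    b X1 X2 X3 = - b X1 X3 X2.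
  move=> v1 v2 v3; have [s2 t2] := v2; have [s3 t3] := v3.
  have := mN X1 X2 X3 v1 v2 v3 p; rewrite [LHS](deriv_at_dot p (X1 p) s2 s3) /g => E.
  rewrite /b !dotBl !dot_sphere_connection // (dotC _ (X2 p)).
  by rewrite (dotC (deriv_along X1 X3 p)) /deriv_along -!/(deriv_at _ _ _); lra.
have [_ tX] := vX; have [_ tY] := vY.
apply: (eq_tangent (p := p)); first by case: (vN X Y vX vY).
  exact: tangent_sphere_connection.
move=> z pz; apply/eqP; rewrite -subr_eq0 -dotBl.
(* [b] takes fields, so the test vector [z] is realized as the value of [ext z] at [p]. *)
rewrite -(tproj_tangent pz) -/(ext z p) -/(b X Y (ext z)).
have vz := vector_field_ext z.
have := bsym Y X (ext z) vY vX; have := bsym X (ext z) Y vX vz.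
have := bsym (ext z) Y X vz vY.
have := bskew X Y _ vX vY vz; have := bskew Y X _ vY vX vz.
have := bskew _ X Y vz vX vY.
by move=> *; apply/eqP; lra.
Qed.

Lemma sum_dot_tproj p :
  \sum_(i < 8) dot (tproj p (e_ i)) (tproj p (e_ i)) = 7 :> R.
Proof.
have E1 i : dot (tproj p (e_ i)) (tproj p (e_ i)) =
    1 - dot (val p) (e_ i) * dot (e_ i) (val p).
  rewrite dot_tproj; last exact: tangent_tproj.
  rewrite dotBr dot_delta mxE !eqxx dotZr; congr (1 - _).
  by rewrite (dotC (val p)).
rewrite (eq_bigr _ (fun i _ => E1 i)) sumrB parseval dot_valP sumr_const card_ord.
by ring.
Qed.

End VectorFields.

(** * Metric connections with skew torsion *)

Section SkewPerturbation.
Context {R : realType}.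
Local Notation E := (R8 R).
Local Notation S7 := (S7 R).
Implicit Types (p : S7) (X Y Z : S7 -> E).

Context {nablag nabla : (S7 -> E) -> (S7 -> E) -> (S7 -> E)} {A : S7 -> E -> E -> E}.
Context (hg : levi_civita nablag).
Context (nablaE : forall X Y p, vector_field X -> vector_field Y ->
  nabla X Y p = nablag X Y p + A p (X p) (Y p)).
Context (A_tangent : forall p x y, tangent p x -> tangent p y -> tangent p (A p x y)).
Context (A_smooth : forall X Y, vector_field X -> vector_field Y ->
  smooth (fun p => A p (X p) (Y p))).
Context (A_alt : forall p x y z, tangent p x -> tangent p y -> tangent p z ->
  dot (A p y x) z = - dot (A p x y) z /\ dot (A p x z) y = - dot (A p x y) z).

Lemma A_skew p x y : tangent p x -> tangent p y -> A p y x = - A p x y.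
Proof.
move=> px py; apply: (eq_tangent (p := p));
  [exact: A_tangent|exact/tangentN/A_tangent|].
by move=> z pz; rewrite dotNl; case: (A_alt px py pz).
Qed.

Lemma A_diag p x y : tangent p x -> tangent p y -> dot (A p x y) x = 0.
Proof.
move=> px py; have [+ _] := A_alt px px py; have [_ +] := A_alt px px py.
by move=> -> ?; lra.
Qed.

Lemma A_rot p x y z : tangent p x -> tangent p y -> tangent p z ->
  dot (A p y z) x = dot (A p x y) z.
Proof.
by move=> px py pz; have [_ ->] := A_alt py px pz; have [-> _] := A_alt px py pz;
  rewrite opprK.
Qed.

Lemma vector_field_nabla X Y : vector_field X -> vector_field Y ->
  vector_field (nabla X Y).
Proof.
move=> vX vY; have -> : nabla X Y = fun p => nablag X Y p + A p (X p) (Y p).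
  by apply/funext => p; exact: nablaE.
apply: vector_fieldD; first by have [[+ _] _] := hg; exact.
have [sX tX] := vX; have [sY tY] := vY.
by split; [exact: A_smooth|move=> p; exact: A_tangent].
Qed.

Lemma metric_nabla : metric_connection nabla.
Proof.
move=> X Y Z vX vY vZ p; have [_ [mg _]] := hg; rewrite mg // /g !nablaE //.
have [[[_ tX] [_ tY]] [_ tZ]] := (vX, vY, vZ).
rewrite dotDl dotDr; have [_ E] := A_alt (tX p) (tY p) (tZ p).
by rewrite (dotC (Y p) (A _ _ _)) E; ring.
Qed.

Lemma torsion_nabla X Y p : vector_field X -> vector_field Y ->
  torsion nabla X Y p = 2 *: A p (X p) (Y p).
Proof.
move=> vX vY; have [_ [_ tg]] := hg; have := tg X Y vX vY p.
have [_ tX] := vX; have [_ tY] := vY.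
rewrite /torsion !nablaE // (A_skew (tX p) (tY p)) => T0.
have aux (u w l a : E) : u - w - l = 0 -> u + a - (w - a) - l = 2 *: a.
  move/eqP; rewrite subr_eq0 => /eqP <-; rewrite !opprB addrA.
  by rewrite -(addrA (u + a) _ w) subrK -(addrA u) addrAC subrr add0r scaler_nat mulr2n.
exact: aux.
Qed.

Lemma skew_torsion_nabla : skew_torsion nabla.
Proof.
split; [|split; [|split]].
- move=> X Y Z vX vY [sZ _]; have [sX _] := vX; have [sY _] := vY.
  have -> : g (torsion nabla X Y) Z = fun p => dot (2 *: A p (X p) (Y p)) (Z p).
    by apply/funext => p; rewrite /g torsion_nabla.
  apply: smooth_dot => //; apply: smooth_scale; first exact: smooth_cst.
  exact: A_smooth.
- move=> X X' Y Z vX vX' vY vZ p; rewrite /g !torsion_nabla //;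
  last exact: vector_fieldD.
  have [[[[_ tX] [_ tY]] [_ tZ]] [_ tX']] := (vX, vY, vZ, vX').
  have tXX := tangentD (tX p) (tX' p).
  rewrite !dotZl -!(A_rot (x := X p
    + _)) // -(A_rot (x := X p)) // -(A_rot (x := X' p)) //.
  by rewrite dotDr mulrDr.
- move=> f X Y Z sf vX vY vZ p; rewrite /g !torsion_nabla //;
  last exact: vector_field_scale.
  have [[[_ tX] [_ tY]] [_ tZ]] := (vX, vY, vZ).
  have tfX := tangentZ (f p) (tX p).
  rewrite !dotZl -!(A_rot (x := f p *: X p)) // -(A_rot (x := X p)) //.
  by rewrite dotZr mulrCA.
move=> X Y Z vX vY vZ p; rewrite /g !torsion_nabla // !dotZl.
have [[[_ tX] [_ tY]] [_ tZ]] := (vX, vY, vZ).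
by have [-> ->] := A_alt (tX p) (tY p) (tZ p); rewrite !mulrN.
Qed.

(** Pairing with a tangent [w] discards the normal corrections, but differentiating the factor $q$
    in $\langle Y,Z\rangle q$ leaves $\langle Y,Z\rangle u$, the source of the round curvature. *)
Lemma dot_nabla_nabla p u w X Y Z : vector_field X -> vector_field Y ->
  vector_field Z ->
  X p = u -> tangent p w ->
  dot (nabla X (nabla Y Z) p) w =
    dot (deriv_along X (deriv_along Y Z) p) w + dot (Y p) (Z p) * dot u w
    + dot (deriv_at p u (fun q => A q (Y q) (Z q))) w + dot (A p u (nabla Y Z p)) w.
Proof.
move=> vX vY vZ Xp pw; have [[[sX tX] [sY tY]] [sZ tZ]] := (vX, vY, vZ).
have sAYZ := A_smooth vY vZ.
have sYZ : smooth (fun q => dot (Y q) (Z q) *: val q).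
  by apply: smooth_scale; [exact: smooth_dot|exact: smooth_val].
have sDYZ := smooth_deriv_along sY sZ.
have vYZ := vector_field_nabla vY vZ.
have nYZ : nabla Y Z = fun q => (deriv_along Y Z q + dot (Y q) (Z q) *: val q)
  + A q (Y q) (Z q).
  by apply/funext => q; rewrite nablaE // levi_civita_sphere.
rewrite nablaE // levi_civita_sphere // dotDl dot_sphere_connection // Xp.
congr (_ + _).
have pu : tangent p u by rewrite -Xp.
have sf := smooth_dot sY sZ.
have -> : deriv_along X (nabla Y Z) p = deriv_at p u (deriv_along Y Z) +
   (deriv_at p u ((fun q => dot (Y q) (Z q)) : S7 ->
     R^o) *: val p + dot (Y p) (Z p) *: u) +
   deriv_at p u (fun q => A q (Y q) (Z q)).
  rewrite -[LHS]/(deriv_at p (X p) (nabla Y Z)) Xp nYZ deriv_atD //;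
    last exact: smoothD.
  by rewrite deriv_atD // (deriv_at_scale _ _ sf smooth_val) deriv_at_val.
rewrite !dotDl !dotZl (dotC (val p)) [dot w _]pw mulr0 add0r.
by rewrite /deriv_along Xp.
Qed.

(* The only part of the curvature where the derivative of [A] enters. *)
Definition skew_part (p : S7) (v : E) Y Z : R :=
  dot (deriv_at p v (fun q => A q (Y q) (Z q))) v
  - dot (A p v (Y p)) (sphere_connection (ext v) Z p)
  + dot (A p v (Z p)) (sphere_connection (ext v) Y p).

Lemma skew_partC p v Y Z : tangent p v -> vector_field Y -> vector_field Z ->
  skew_part p v Z Y = - skew_part p v Y Z.
Proof.
move=> pv vY vZ; rewrite /skew_part.
have -> : (fun q => A q (Z q) (Y q)) = fun q => - A q (Y q) (Z q).
  by apply/funext => q; apply: A_skew; [exact: vY.2|exact: vZ.2].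
by rewrite deriv_atN ?dotNl; [ring|exact: A_smooth].
Qed.

Lemma curvature_diag p v Y Z : tangent p v -> vector_field Y -> vector_field Z ->
  dot (curvature nabla (ext v) Y Z p) v =
  dot v v * dot (Y p) (Z p) - dot v (Y p) * dot v (Z p)
  - dot (A p v (Y p)) (A p v (Z p)) + skew_part p v Y Z.
Proof.
move=> pv vY vZ; have vX := vector_field_ext v.
have [[[sX tX] [sY tY]] [sZ tZ]] := (vX, vY, vZ).
have Xp : ext v p = v by exact: tproj_tangent.
have vXY := vector_field_bracket vX vY.
have vnYZ := vector_field_nabla vY vZ; have vnXZ := vector_field_nabla vX vZ.
rewrite /curvature !dotBl (dot_nabla_nabla vX vY vZ Xp pv).
rewrite (dot_nabla_nabla vY vX vZ erefl pv) Xp.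
rewrite (A_diag pv (vnYZ.2 p)).
(* $\langle A(X,Z),X\rangle$ vanishes identically. Its derivative has two parts, and the one
   differentiating the last $X$ is zero because that derivative is normal while [A] is tangent. *)
have -> : dot (deriv_at p (Y p) (fun q => A q (ext v q) (Z q))) v = 0.
  have := deriv_at_dot p (Y p) (A_smooth vX vZ) sX.
  have -> : (fun q => dot (A q (ext v q) (Z q)) (ext v q)) = fun _ => 0.
    by apply/funext => q; exact: A_diag.
  rewrite deriv_at_cst deriv_at_ext // dotZr Xp [dot (A _ _ _) (val p)](A_tangent pv
    (tZ p)).
  by rewrite mulr0 addr0.
rewrite (A_rot pv (tY p) (vnXZ.2 p)).
(* At [p] the derivative of [ext v] along [Y] is $-\langle v,Y\rangle p$, so the bracket takes the
   value of [sphere_connection (ext v) Y] there. *)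
have -> : dot (nabla (lie_bracket (ext v) Y) Z p) v =
    dot (deriv_along (lie_bracket (ext v) Y) Z p) v
    - dot (A p v (Z p)) (sphere_connection (ext v) Y p).
  rewrite nablaE // levi_civita_sphere // dotDl dot_sphere_connection //.
  congr (_ + _); rewrite (A_rot pv (vXY.2 p) (tZ p)).
  have [_ ->] := A_alt pv (tZ p) (vXY.2 p); congr (- dot _ _).
  rewrite /lie_bracket /sphere_connection -[deriv_along Y _ p]/(deriv_at p (Y p) (ext
    v)).
  by rewrite deriv_at_ext // scaleNr opprK Xp.
(* This splitting yields the surviving term quadratic in [A]. *)
have -> : nabla (ext v) Z p = sphere_connection (ext v) Z p + A p v (Z p).
  by rewrite nablaE // levi_civita_sphere // Xp.
have := deriv_along_bracket sX sY sZ (tX p) (tY p).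
move/(congr1 (fun u : E => dot u v)); rewrite dotBl => <-.
rewrite /skew_part dotDr (dotC (Y p) v).
have collect (d1 d2 c1 c2 c3 c4 T n1 a m : R) :
    d1 + c1 * c2 + T + 0 - (d2 + c3 * c4 + 0 + (n1 + a)) - (d1 - d2 - m) =
    c2 * c1 - c4 * c3 - a + (T - n1 + m) by ring.
exact: collect.
Qed.

Lemma tangent_curvature p X Y Z : vector_field X -> vector_field Y -> vector_field Z ->
  tangent p (curvature nabla X Y Z p).
Proof.
move=> vX vY vZ; have vnYZ := vector_field_nabla vY vZ.
have vnXZ := vector_field_nabla vX vZ; have vXY := vector_field_bracket vX vY.
apply: tangentB; first apply: tangentB.
- by case: (vector_field_nabla vX vnYZ).
- by case: (vector_field_nabla vY vnXZ).
by case: (vector_field_nabla vXY vZ).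
Qed.

(** Curvature values are tangent, so pairing with a basis vector equals pairing with its projection;
    each summand then has the diagonal form of [curvature_diag]. *)
Lemma Ric_diag p Y Z : vector_field Y -> vector_field Z ->
  Ric nabla Y Z p = \sum_(i < 8) dot (curvature nabla (ext (tproj p (e_ i))) Y Z p)
    (tproj p (e_ i)).
Proof.
move=> vY vZ; apply: eq_bigr => i _.
have vX := vector_field_ext (tproj p (e_ i)).
have pc := tangent_curvature p vX vY vZ.
exact: etrans (dotC _ _) (etrans (esym (dot_tproj _ pc)) (dotC _ _)).
Qed.

Lemma SymRic_nabla Y Z p : vector_field Y -> vector_field Z ->
  SymRic nabla Y Z p = 6 * dot (Y p) (Z p) -
    \sum_(i < 8) dot (A p (tproj p (e_ i)) (Y p)) (A p (tproj p (e_ i)) (Z p)).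
Proof.
move=> vY vZ; rewrite /SymRic !Ric_diag // -big_split /=.
have [_ tY] := vY; have [_ tZ] := vZ.
(* The constant 6 is the dimension 7 of the tangent space minus the 1 contributed by Parseval. *)
have sum_sphere : \sum_(i < 8) (dot (tproj p (e_ i)) (tproj p (e_ i)) * dot (Y p) (Z p)
   - dot (tproj p (e_ i)) (Y p) * dot (tproj p (e_ i)) (Z p)) = 6 * dot (Y p) (Z p).
  rewrite sumrB -mulr_suml.
  have -> : \sum_(i < 8) dot (tproj p (e_ i)) (tproj p (e_ i)) = 7 :> R.
    exact: sum_dot_tproj.
  have -> : \sum_(i < 8) dot (tproj p (e_ i)) (Y p) * dot (tproj p (e_ i)) (Z p) =
    dot (Y p) (Z p).
    rewrite -parseval; apply: eq_bigr => i _.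
    by rewrite !dot_tproj // (dotC (e_ i) (Y p)).
  by ring.
rewrite -sum_sphere -sumrB mulr_suml; apply: eq_bigr => i _.
have pe := tangent_tproj p (e_ i).
rewrite (curvature_diag pe vY vZ) (curvature_diag pe vZ vY) (skew_partC pe vY vZ).
rewrite (dotC (Z p)) (dotC (A p _ (Z p))).
have collect (vv yz vy vz a T : R) :
    (vv * yz - vy * vz - a + T + (vv * yz - vz * vy - a - T)) / 2 =
    vv * yz - vy * vz - a by field.
exact: collect.
Qed.

End SkewPerturbation.

(** * The quaternionic tensors on R^8 *)

Lemma big_ord4 (V : nmodType) (F : 'I_4 -> V) :
  \sum_(i < 4) F i = F 0 + F 1 + F 2 + F 3.
Proof.
rewrite !big_ord_recl big_ord0 addr0 !addrA.
by congr (F _ + F _ + F _ + F _); apply: val_inj.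
Qed.

Section Coordinates.
Context {R : realType}.
Local Notation E := (R8 R).
Local Notation S7 := (S7 R).
Local Notation C := R[i].

Lemma ofCK (z : 'cV[C]_4) : toC (ofC z) = z.
Proof.
apply/colP => a; rewrite !mxE !(unsplitK (inl _)) !(unsplitK (inr _)) !mxE.
by case: (z a 0).
Qed.

Lemma toC_qact (u : C * C) (x : E) :
  let z a := toC x a 0 in
  toC (qact u x) = \col_a tnth [tuple u.1 * z 0 - u.2 * conjc (z 1);
    u.1 * z 1 + u.2 * conjc (z 0); u.1 * z 2 - u.2 * conjc (z 3);
    u.1 * z 3 + u.2 * conjc (z 2)] a.
Proof. by rewrite /= /qact /ofH ofCK. Qed.

Variant imaginary_unit := Qi | Qj | Qk.

Definition unit_index s : 'I_3 := match s with Qi => 0 | Qj => 1 | Qk => 2 end.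

(* Behind an opaque proof, so that rewriting with the coordinates of [J] does
   not unfold quaternions. *)
Lemma J_sig : {J : imaginary_unit -> E -> E |
  forall s x, J s x = qact (qunit (unit_index s)) x}.
Proof. by exists (fun s x => qact (qunit (unit_index s)) x). Qed.

Definition J := sval J_sig.

Lemma JE s (x : E) : J s x = qact (qunit (unit_index s)) x.
Proof. exact: (svalP J_sig). Qed.

(** Sealed like [J], so that coordinates stay atoms for [ring]; natural-number indices avoid
    comparing ordinals with different bound proofs. *)
Lemma coord_sig : {coord : E -> nat -> R | forall x k, coord x k = x (inord k) 0}.
Proof. by exists (fun x k => x (inord k) 0). Qed.

Definition coord := sval coord_sig.

Lemma coordE (x : E) k : coord x k = x (inord k) 0.
Proof. exact: (svalP coord_sig). Qed.

Lemma coord_Re (x : E) (a : 'I_4) : coord x a = complex.Re (toC x a 0).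
Proof. by rewrite mxE coordE; congr (x _ 0); apply: val_inj;
  rewrite /= inordK // (ltn_trans (ltn_ord a)). Qed.

Lemma coord_Im (x : E) (a : 'I_4) : coord x (4 + a) = complex.Im (toC x a 0).
Proof. by rewrite mxE coordE; congr (x _ 0); apply: val_inj;
  rewrite /= inordK // (ltn_add2l 4 a 4). Qed.

Lemma dotE (x y : E) : dot x y =
  coord x 0 * coord y 0 + coord x 1 * coord y 1 + coord x 2 * coord y 2
    + coord x 3 * coord y 3
  + (coord x 4 * coord y 4 + coord x 5 * coord y 5 + coord x 6 * coord y 6
    + coord x 7 * coord y 7).
Proof.
rewrite /dot (@big_split_ord _ _ _ 4 4) /= !big_ord4 !coordE.
by congr (x _ 0 * y _ 0 + x _ 0 * y _ 0 + x _ 0 * y _ 0 + x _ 0 * y _ 0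
  + (x _ 0 * y _ 0 + x _ 0 * y _ 0 + x _ 0 * y _ 0 + x _ 0 * y _ 0));
  apply: val_inj; rewrite /= inordK.
Qed.

Lemma coord_toC (x : E) :
  (coord x 0 = complex.Re (toC x 0 0)) * (coord x 1 = complex.Re (toC x 1 0))
  * (coord x 2 = complex.Re (toC x 2 0)) * (coord x 3 = complex.Re (toC x 3 0))
  * (coord x 4 = complex.Im (toC x 0 0)) * (coord x 5 = complex.Im (toC x 1 0))
  * (coord x 6 = complex.Im (toC x 2 0)) * (coord x 7 = complex.Im (toC x 3 0)).
Proof.
by rewrite -(coord_Re x 0) -(coord_Re x 1) -(coord_Re x 2) -(coord_Re x 3)
  -(coord_Im x 0) -(coord_Im x 1) -(coord_Im x 2) -(coord_Im x 3).
Qed.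

(** On a pair $(z,w)$ the units act by $(iz,iw)$, $(-\bar w,\bar z)$ and $(-i\bar w,i\bar z)$.
    Indices $k$ and $4+k$ hold real and imaginary parts; the wildcard stands for 7. *)
Definition coord_J_rhs s (x : E) (k : nat) : R :=
  match s, k with
  | Qi, 0 => - coord x 4 | Qi, 1 => - coord x 5 | Qi, 2 => - coord x 6 | Qi, 3 => - coord x 7
  | Qi, 4 => coord x 0 | Qi, 5 => coord x 1 | Qi, 6 => coord x 2 | Qi, _ => coord x 3
  | Qj, 0 => - coord x 1 | Qj, 1 => coord x 0 | Qj, 2 => - coord x 3 | Qj, 3 => coord x 2
  | Qj, 4 => coord x 5 | Qj, 5 => - coord x 4 | Qj, 6 => coord x 7 | Qj, _ => - coord x 6
  | Qk, 0 => - coord x 5 | Qk, 1 => coord x 4 | Qk, 2 => - coord x 7 | Qk, 3 => coord x 6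
  | Qk, 4 => - coord x 1 | Qk, 5 => coord x 0 | Qk, 6 => - coord x 3 | Qk, _ => coord x 2
  end.

Lemma coord_J s (x : E) :
  (coord (J s x) 0 = coord_J_rhs s x 0) * (coord (J s x) 1 = coord_J_rhs s x 1)
  * (coord (J s x) 2 = coord_J_rhs s x 2) * (coord (J s x) 3 = coord_J_rhs s x 3)
  * (coord (J s x) 4 = coord_J_rhs s x 4) * (coord (J s x) 5 = coord_J_rhs s x 5)
  * (coord (J s x) 6 = coord_J_rhs s x 6) * (coord (J s x) 7 = coord_J_rhs s x 7).
Proof.
by case: s; do ![split]; rewrite /coord_J_rhs !coord_toC JE !toC_qact !mxE !(tnth_nth
  0) /=; simpc.
Qed.

End Coordinates.

Ltac coord_ring := rewrite ?(dotNl, dotNr) !dotE; do ?rewrite !coord_J /coord_J_rhs;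
  ring.

(** * Ambient extensions of the contact tensors *)

Section ContactTensors.
Context {R : realType}.
Local Notation E := (R8 R).

Lemma J_lin s : real_linear (J s : E -> E).
Proof. by move=> a x y; rewrite !JE; exact: qact_linear. Qed.

Lemma J_skew s (x y : E) : dot (J s x) y = - dot x (J s y).
Proof. by case: s; coord_ring. Qed.

Lemma J_isom s (x y : E) : dot (J s x) (J s y) = dot x y.
Proof. by case: s; coord_ring. Qed.

Lemma J_diag s (x : E) : dot x (J s x) = 0.
Proof. by have := J_skew s x x; rewrite dotC; lra. Qed.

Lemma J_orth s t (x : E) : s <> t -> dot (J s x) (J t x) = 0.
Proof. by case: s; case: t => // _; coord_ring. Qed.

(* [<eta_Phi s p x y, z> = (eta_s /\ Phi_s)(x,y,z)]; this extension to all of R^8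
   vanishes when [x], [y] or [z] is normal. *)
Definition eta_Phi s (p x y : E) : E :=
  - dot x (J s y) *: J s p + dot x (J s p) *: J s y - dot y (J s p) *: J s x.

Definition ambient_Theta (p x y : E) : E := eta_Phi Qj p x y - eta_Phi Qk p x y.

(** The tensor [A], with $(c,a,b)=(r,\mathrm{Re}\,q,\mathrm{Im}\,q)$. The minus sign arises from
    $\langle\Theta,iz\rangle=-\langle i\Theta,z\rangle$ in the definition of $\widetilde\Theta$. *)
Definition skew_tensor (c a b : R) (p x y : E) : E := c *: eta_Phi Qi p x y
  + a *: ambient_Theta p x y - b *: J Qi (ambient_Theta p x y).

Lemma dot_eta_Phi s p x y z : dot (eta_Phi s p x y) z =
  - dot x (J s y) * dot (J s p) z + dot x (J s p) * dot (J s y) z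
  - dot y (J s p) * dot (J s x) z.
Proof. by rewrite /eta_Phi !dotDl dotNl !dotZl. Qed.

Lemma dot_Theta p x y z : dot (ambient_Theta p x y) z =
  dot (eta_Phi Qj p x y) z - dot (eta_Phi Qk p x y) z.
Proof. exact: dotBl. Qed.

Lemma eta_Phi_swap s p x y : eta_Phi s p y x = - eta_Phi s p x y.
Proof.
apply: eq_dot => z; rewrite dotNl !dot_eta_Phi (dotC y (J s x)) J_skew.
by ring.
Qed.

Lemma dot_eta_Phi_swap s p x y z : dot (eta_Phi s p x z) y = - dot (eta_Phi s p x y) z.
Proof.
rewrite !dot_eta_Phi (dotC (J s p) y) (dotC (J s p) z) (J_skew s z y) (dotC z (J s y)).
rewrite (J_skew s x y) (J_skew s x z); ring.
Qed.

Lemma eta_Phi_normal s p y : eta_Phi s p p y = 0.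
Proof.
apply: eq_dot => z; rewrite dot0l dot_eta_Phi J_diag (dotC y (J s p)) (J_skew s p y).
by ring.
Qed.

Lemma Theta_swap p x y : ambient_Theta p y x = - ambient_Theta p x y.
Proof. by rewrite /ambient_Theta (eta_Phi_swap Qj p x) (eta_Phi_swap Qk p x) -opprD.
  Qed.

Lemma Theta_normal p y : ambient_Theta p p y = 0.
Proof. by rewrite /ambient_Theta !eta_Phi_normal subrr. Qed.

(** $\Omega$ is the real part of a complex multilinear alternating form, so a factor $i$ may move
    from one slot to another. *)
Lemma dot_JTheta_swap p x y z : dot (J Qi (ambient_Theta p x z)) y =
  - dot (J Qi (ambient_Theta p x y)) z.
Proof. by rewrite !J_skew !dot_Theta !dot_eta_Phi; coord_ring. Qed.

Lemma J_basis_sum s t : s <> t ->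
  \sum_(i < 8) dot (J s (e_ i)) (J t (e_ i)) = 0 :> R.
Proof. by move=> st; rewrite big1 // => i _; exact: J_orth. Qed.

Lemma J_basis_sum_diag s :
  \sum_(i < 8) dot (J s (e_ i)) (J s (e_ i)) = 8 :> R.
Proof.
under eq_bigr => i _ do rewrite J_isom dot_delta mxE !eqxx.
by rewrite sumr_const card_ord.
Qed.

(* Frobenius product of the linear maps
   [x |-> <x,u1> v1 + <x,u2> v2 + c P x] and [x |-> <x,w1> t1 + <x,w2> t2 + d Q x]. *)
Lemma frobenius (u1 v1 u2 v2 w1 t1 w2 t2 : E) (c d : R) (P Q : E -> E) :
  real_linear P -> real_linear Q ->
  \sum_(i < 8) dot
     (dot (e_ i) u1 *: v1 + dot (e_ i) u2 *: v2 + c *: P (e_ i))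
     (dot (e_ i) w1 *: t1 + dot (e_ i) w2 *: t2 + d *: Q (e_ i)) =
  dot u1 w1 * dot v1 t1 + dot u1 w2 * dot v1 t2 + d * dot v1 (Q u1)
  + (dot u2 w1 * dot v2 t1 + dot u2 w2 * dot v2 t2 + d * dot v2 (Q u2))
  + (c * dot (P w1) t1 + c * dot (P w2) t2
     + c * d * \sum_(i < 8) dot (P (e_ i)) (Q (e_ i))).
Proof.
move=> linP linQ.
have dotb (x : E) i : dot (e_ i) x = x i 0 by rewrite dotC dot_delta.
have rankone (u w : E) :
    \sum_(i < 8) dot (e_ i) u * dot (e_ i) w = dot u w.
  by apply: eq_bigr => i _; rewrite !dotb.
have image (L : E -> E) (u w : E) : real_linear L ->
    \sum_(i < 8) dot (e_ i) u * dot (L (e_ i)) w = dot (L u) w.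
  move=> linL; rewrite (lin_basis linL u) dot_suml; apply: eq_bigr => i _.
  by rewrite dotZl dotb.
rewrite -(rankone u1 w1) -(rankone u1 w2) -(rankone u2 w1) -(rankone u2 w2).
rewrite (dotC v1 (Q u1)) (dotC v2 (Q u2)) -(image Q u1 v1 linQ) -(image Q u2 v2 linQ).
rewrite -(image P w1 t1 linP) -(image P w2 t2 linP).
rewrite !mulr_suml !mulr_sumr -!big_split; apply: eq_bigr => i _ /=.
rewrite !(dotDl, dotDr, dotZl, dotZr) (dotC v1 (Q _)) (dotC v2 (Q _)).
by ring.
Qed.

End ContactTensors.

(** * Quadratic traces of the contact tensors *)

Section Gram.
Context {R : realType}.
Local Notation E := (R8 R).
Local Notation S7 := (S7 R).
Local Notation C := R[i].
Implicit Types (p x y z : E).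

(** The shape required by [frobenius]: as a map of [x], two rank-one terms and a multiple of
    [J s]. *)
Lemma eta_Phi_rankone s p x y : eta_Phi s p x y =
  dot x (J s y) *: (- J s p) + dot x (J s p) *: J s y + (- dot y (J s p)) *: J s x.
Proof. by rewrite /eta_Phi scalerN !scaleNr. Qed.

Lemma J_eta_Phi_rankone s p x y : J Qi (eta_Phi s p x y) =
  dot x (J s y) *: (- J Qi (J s p)) + dot x (J s p) *: J Qi (J s y)
  + (- dot y (J s p)) *: J Qi (J s x).
Proof.
have L := @J_lin R Qi.
by rewrite eta_Phi_rankone !(linD L) !(linZ L) (linN L).
Qed.

Lemma J_comp_lin s t : real_linear (fun x : E => J s (J t x)).
Proof. by move=> a x y; rewrite !J_lin. Qed.

Lemma dot_Theta_r p x y z : dot z (ambient_Theta p x y) =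
  dot z (eta_Phi Qj p x y) - dot z (eta_Phi Qk p x y).
Proof. exact: dotBr. Qed.

(** Reduces to $\langle y,z\rangle$ for tangent vectors at a unit [p]. Homogeneity in [p] makes the
    trace formulas polynomial identities without side conditions. *)
Definition gram_form p y z : R := dot p p * dot y z - dot p y * dot p z.

(** The constants at a unit [p]: for unit $y=z$ orthogonal to $p$ and $ip$, the map of [x] has two
    unit singular values, giving 2. For $y=z=ip$ it is $-i$ on the six-dimensional complement of
    $p,ip$ and zero on their span, giving $6=2+4$. *)
Lemma gram_eta_Phi_Qi p y z :
  \sum_(i < 8) dot (eta_Phi Qi p (e_ i) y) (eta_Phi Qi p (e_ i) z) =
  2 * gram_form p y z + 4 * (dot y (J Qi p) * dot z (J Qi p)).
Proof.
under eq_bigr => i _ do rewrite !eta_Phi_rankone.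
rewrite frobenius; try exact: J_lin.
by rewrite J_basis_sum_diag /gram_form; coord_ring.
Qed.

(** The trace on the right stays symbolic: it is 8 if [s = t] and 0 otherwise. *)
Lemma gram_eta_Phi s t p y z :
  \sum_(i < 8) dot (eta_Phi s p (e_ i) y) (eta_Phi t p (e_ i) z) =
  dot (J s y) (J t z) * dot (J s p) (J t p) - dot (J s y) (J t p) * dot (J s p) (J t z)
  + dot z (J t p) * dot (J s p) (J t (J s y))
  + (dot (J s p) (J t p) * dot (J s y) (J t z)
    - dot (J s p) (J t z) * dot (J s y) (J t p)
  - dot z (J t p) * dot (J s y) (J t (J s p)))
  + dot y (J s p) * (dot (J s (J t z)) (J t p) - dot (J s (J t p)) (J t z)
  + dot z (J t p) * \sum_(i < 8) dot (J s (e_ i)) (J t (e_ i))).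
Proof.
under eq_bigr => i _ do rewrite !eta_Phi_rankone.
rewrite frobenius; try exact: J_lin.
move: (\sum_(i < 8) _) => n; rewrite !(dotNl, dotNr) (dotC (J s p) (J t z)); ring.
Qed.

(** At a unit [p], $\Theta(\cdot,y)$ vanishes for $y=ip$, since the complex determinant does. For
    unit [y] orthogonal to $p$ and $ip$ it is an isometry of the real four-dimensional complement of
    the complex span of $p,y$ and zero on that span, whence the 4. *)
Lemma gram_Theta p y z :
  \sum_(i < 8) dot (ambient_Theta p (e_ i) y) (ambient_Theta p (e_ i) z) =
  4 * (gram_form p y z - dot y (J Qi p) * dot z (J Qi p)).
Proof.
have dWW (u w : E) : dot (ambient_Theta p u y) (ambient_Theta p w z) =
    dot (eta_Phi Qj p u y) (eta_Phi Qj p w z)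
      - dot (eta_Phi Qj p u y) (eta_Phi Qk p w z)
    - (dot (eta_Phi Qk p u y) (eta_Phi Qj p w z)
      - dot (eta_Phi Qk p u y) (eta_Phi Qk p w z)).
  by rewrite dot_Theta !dot_Theta_r.
rewrite (eq_bigr _ (fun i _ => dWW (e_ i) (e_ i))) !sumrB.
rewrite !gram_eta_Phi !J_basis_sum_diag !J_basis_sum // /gram_form.
coord_ring.
Qed.

(** Excludes products of [r] with $\mathrm{Re}\,q$ from the Ricci tensor. *)
Lemma gram_eta_Phi_Theta p y z :
  \sum_(i < 8) dot (eta_Phi Qi p (e_ i) y) (ambient_Theta p (e_ i) z) = 0.
Proof.
rewrite (eq_bigr _ (fun i _ => dot_Theta_r _ _ _ _)) sumrB.
rewrite !gram_eta_Phi !J_basis_sum //.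
coord_ring.
Qed.

(** The counterpart for $\mathrm{Im}\,q$. The trace pairs $ix$ with $i(jx)$ or $i(kx)$; as $i$ is an
    isometry this is $\langle x,jx\rangle$ or $\langle x,kx\rangle$, which is zero. *)
Lemma gram_eta_Phi_JTheta p y z :
  \sum_(i < 8) dot (eta_Phi Qi p (e_ i) y) (J Qi (ambient_Theta p (e_ i) z)) = 0.
Proof.
pose F t := @frobenius R (J Qi y) (- J Qi p) (J Qi p) (J Qi y)
  (J t z) (- J Qi (J t p)) (J t p) (J Qi (J t z)) (- dot y (J Qi p)) (- dot z (J t p))
  (J Qi) (fun x => J Qi (J t x)) (J_lin Qi) (J_comp_lin Qi t).
have BJ t i := congr2 (@dot R) (eta_Phi_rankone Qi p (e_ i) y)
  (J_eta_Phi_rankone t p (e_ i) z).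
have G t := etrans (eq_bigr _ (fun i _ => BJ t i)) (F t); cbv beta in G.
have BJW i : dot (eta_Phi Qi p (e_ i) y) (J Qi (ambient_Theta p (e_ i) z)) =
    dot (eta_Phi Qi p (e_ i) y) (J Qi (eta_Phi Qj p (e_ i) z)) -
    dot (eta_Phi Qi p (e_ i) y) (J Qi (eta_Phi Qk p (e_ i) z)).
  by rewrite -dotBr -(linB (@J_lin R Qi)).
have trace0 t : \sum_(i < 8) dot (J Qi (e_ i)) (J Qi (J t (e_ i))) = 0 :> R.
  by rewrite big1 // => i _; rewrite J_isom J_diag.
rewrite (eq_bigr _ (fun i _ => BJW i)) sumrB.
rewrite (G Qj) (G Qk) !trace0 !J_isom; coord_ring.
Qed.

End Gram.

(** * The combined tensor and its identification with the given connection *)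

Section SasakiTensors.
Context {R : realType}.
Local Notation E := (R8 R).
Local Notation S7 := (S7 R).
Local Notation C := R[i].
Implicit Types (x y z : E).

Section SkewTensor.
Context (c a b : R).

Lemma dot_skew_tensor p x y z : dot (skew_tensor c a b p x y) z =
  c * dot (eta_Phi Qi p x y) z
    + a * dot (ambient_Theta p x y) z - b * dot (J Qi (ambient_Theta p x y)) z.
Proof. by rewrite /skew_tensor dotBl dotDl !dotZl. Qed.

(** Here $|q|^2$ appears: [J Qi] is an isometry, which gives $a^2+b^2$, and it is skew, which
    cancels the $ab$ terms. *)
Lemma dot_skew_tensor_pair p u w y z : dot (skew_tensor c a b p u y) (skew_tensor c a b
  p w z) =
  c ^+ 2 * dot (eta_Phi Qi p u y) (eta_Phi Qi p w z)
  + (a ^+ 2 + b ^+ 2) * dot (ambient_Theta p u y) (ambient_Theta p w z)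
  + c * a * (dot (eta_Phi Qi p u y) (ambient_Theta p w z)
    + dot (eta_Phi Qi p w z) (ambient_Theta p u y))
  - c * b * (dot (eta_Phi Qi p u y) (J Qi (ambient_Theta p w z))
    + dot (eta_Phi Qi p w z) (J Qi (ambient_Theta p u y))).
Proof.
have expand (s t v x' : E) : dot (c *: s + a *: t - b *: J Qi t) (c *: v
  + a *: x' - b *: J Qi x') =
    c ^+ 2 * dot s v + (a ^+ 2 + b ^+ 2) * dot t x'
    + c * a * (dot s x' + dot v t) - c * b * (dot s (J Qi x') + dot v (J Qi t)).
  rewrite !(dotBl, dotBr, dotDl, dotDr, dotZl, dotZr) J_isom (J_skew Qi t x').
  by rewrite (dotC t v) (dotC (J Qi t) v); ring.
exact: expand.
Qed.

Lemma gram_skew_tensor p y z :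
  \sum_(i < 8) dot (skew_tensor c a b p (e_ i) y) (skew_tensor c a b p (e_ i) z) =
  c ^+ 2 * (2 * gram_form p y z + 4 * (dot y (J Qi p) * dot z (J Qi p)))
  + (a ^+ 2 + b ^+ 2) * (4 * (gram_form p y z - dot y (J Qi p) * dot z (J Qi p))).
Proof.
rewrite (eq_bigr _ (fun i _ => dot_skew_tensor_pair p (e_ i) (e_ i) y z)).
rewrite sumrB !big_split -!mulr_sumr !big_split /=.
rewrite gram_eta_Phi_Qi gram_Theta !gram_eta_Phi_Theta !gram_eta_Phi_JTheta.
by ring.
Qed.

Lemma skew_tensor_swap p x y : skew_tensor c a b p y x = - skew_tensor c a b p x y.
Proof.
apply: eq_dot => z; rewrite dotNl !dot_skew_tensor (eta_Phi_swap Qi p x y) (Theta_swap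
  p x y).
by rewrite (linN (@J_lin R Qi)) !dotNl; ring.
Qed.

Lemma dot_skew_tensor_swap p x y z : dot (skew_tensor c a b p x z) y =
  - dot (skew_tensor c a b p x y) z.
Proof.
rewrite !dot_skew_tensor (dot_eta_Phi_swap Qi p x y z) (dot_JTheta_swap p x y z)
  !dot_Theta.
by rewrite (dot_eta_Phi_swap Qj p x y z) (dot_eta_Phi_swap Qk p x y z); ring.
Qed.

Lemma skew_tensor_normal p y : skew_tensor c a b p p y = 0.
Proof. by rewrite /skew_tensor eta_Phi_normal Theta_normal (lin0 (@J_lin R Qi))
  !scaler0 subr0 addr0. Qed.

Lemma dot_skew_tensor_normal p x y : dot (skew_tensor c a b p x y) p = 0.
Proof. by rewrite dot_skew_tensor_swap skew_tensor_swap skew_tensor_normal oppr0 dot0l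
  oppr0. Qed.

Lemma dot_skew_tensor_rot p x y z : dot (skew_tensor c a b p x y) z =
  dot (skew_tensor c a b p y z) x.
Proof. by rewrite (dot_skew_tensor_swap p y x z) (skew_tensor_swap p x y) dotNl opprK.
  Qed.

(** Allows the frame sum to run over the standard basis of R^8 without projecting. *)
Lemma skew_tensor_tproj (p : S7) x y : skew_tensor c a b (val p) (tproj p x) y =
  skew_tensor c a b (val p) x y.
Proof.
apply: eq_dot => z; rewrite (dot_skew_tensor_rot _ (tproj p x)) (dot_skew_tensor_rot _
  x) dotBr dotZr dot_skew_tensor_normal.
by rewrite mulr0 subr0.
Qed.

Lemma tangent_skew_tensor (p : S7) x y : tangent p (skew_tensor c a b (val p) x y).
Proof. exact: dot_skew_tensor_normal. Qed.

End SkewTensor.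

Lemma etaE (p : S7) s x : eta (unit_index s) p x = - dot x (J s (val p)).
Proof. by rewrite /eta -JE J_skew. Qed.

Lemma psiE (p : S7) s x : psi (unit_index s) p x = J s x + dot x (J s (val p)) *: val p.
Proof. by rewrite /psi etaE -JE scaleNr opprK. Qed.

Lemma PhiE (p : S7) s x y : tangent p x -> Phi (unit_index s) p x y = dot x (J s y).
Proof. by move=> px; rewrite /Phi psiE dotDr dotZr px mulr0 addr0. Qed.

Lemma eta_wedge_PhiE (p : S7) s x y z : tangent p x -> tangent p y -> tangent p z ->
  eta_wedge_Phi (unit_index s) p x y z = dot (eta_Phi s (val p) x y) z.
Proof.
move=> px py pz; rewrite /eta_wedge_Phi !etaE !PhiE // dot_eta_Phi.
rewrite (J_skew s y z) (dotC (J s x) z) (dotC (J s (val p)) z).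
by ring.
Qed.

Lemma OmegaE (p : S7) x y z : tangent p x -> tangent p y -> tangent p z ->
  Omega p x y z = dot (ambient_Theta (val p) x y) z.
Proof.
move=> px py pz; rewrite /Omega dot_Theta -!eta_wedge_PhiE //.
Qed.

Lemma dot_Theta_normal p x y : dot (ambient_Theta p x y) p = 0.
Proof.
have := dot_skew_tensor_normal 0 1 0 p x y; rewrite dot_skew_tensor.
by rewrite !mul0r add0r mul1r subr0.
Qed.

Lemma ThetaE (p : S7) x y : tangent p x -> tangent p y ->
  Theta p x y = ambient_Theta (val p) x y.
Proof.
move=> px py; apply: (eq_tangent (p := p));
  [exact: tangent_sharp|exact: dot_Theta_normal|].
by move=> z pz; rewrite ThetaP // OmegaE.
Qed.

Lemma tangent_psi s (p : S7) x : tangent p (psi s p x).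
Proof. by rewrite /tangent /psi dotBl dotZl dot_valP mulr1 subrr. Qed.

Lemma dot_JTheta_normal p x y : dot (J Qi (ambient_Theta p x y)) p = 0.
Proof.
have := dot_skew_tensor_normal 0 0 1 p x y; rewrite dot_skew_tensor.
by rewrite !mul0r !add0r mul1r => /eqP; rewrite oppr_eq0 => /eqP.
Qed.

Lemma Theta_tildeE (p : S7) x y : tangent p x -> tangent p y ->
  Theta_tilde p x y = - J Qi (ambient_Theta (val p) x y).
Proof.
move=> px py; apply: (eq_tangent (p := p)); first exact: tangent_sharp.
  by rewrite /tangent dotNl dot_JTheta_normal oppr0.
move=> z pz; rewrite Theta_tildeP // OmegaE //; last exact: tangent_psi.
by rewrite (psiE p Qi) dotDr dotZr dot_Theta_normal mulr0 addr0 dotNl J_skew opprK.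
Qed.

Lemma xiE (p : S7) s : xi (unit_index s) p = - J s (val p).
Proof. by rewrite /xi -JE. Qed.

Lemma nabla_rqE nablag c (q : C) (X Y : S7 -> E) p :
  tangent p (X p) -> tangent p (Y p) ->
  nabla_rq nablag c q X Y p =
  nablag X Y p + skew_tensor c (complex.Re q) (complex.Im q) (val p) (X p) (Y p).
Proof.
move=> pX pY; rewrite /nabla_rq ThetaE // Theta_tildeE //.
rewrite /skew_tensor -!addrA; congr (_ + _); rewrite !addrA; congr (_ *: _ + _ + _);
  last by rewrite scalerN.
rewrite (PhiE Qi) // !(etaE p Qi) !(psiE p Qi) (xiE p Qi); apply: eq_dot => z.
rewrite dot_eta_Phi !(dotDl, dotNl, dotZl); ring.
Qed.

Lemma smooth_skew_tensor c a b (X Y : S7 -> E) : smooth X -> smooth Y ->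
  smooth (fun p => skew_tensor c a b (val p) (X p) (Y p)).
Proof.
move=> sX sY; have sJ s (F : S7 -> E) : smooth F -> smooth (fun p => J s (F p)).
  exact/smooth_lin/J_lin.
have sv := @smooth_val R.
have sB s : smooth (fun p => eta_Phi s (val p) (X p) (Y p)).
  have -> : (fun p => eta_Phi s (val p) (X p) (Y p)) = fun p : S7 =>
      dot (X p) (J s (Y p)) *: (- J s (val p)) + dot (X p) (J s (val p)) *: J s (Y p)
      + (- dot (Y p) (J s (val p))) *: J s (X p).
    by apply/funext => p; rewrite -eta_Phi_rankone.
  apply: smoothD; first apply: smoothD.
  - apply: smooth_scale; first by apply: smooth_dot => //; exact: sJ.
    by apply: smoothN; exact: sJ.
  - apply: smooth_scale; first by apply: smooth_dot => //; exact: sJ.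
    exact: sJ.
  apply: smooth_scale; last exact: sJ.
  by apply: smoothN1; apply: smooth_dot => //; exact: sJ.
have sW : smooth (fun p => ambient_Theta (val p) (X p) (Y p)) by exact: smoothB.
have sc (k : R) (F : S7 -> E) : smooth F -> smooth (fun p => k *: F p).
  by move=> sF; apply: smooth_scale => //; exact: smooth_cst.
apply: smoothB; last by apply: sc; exact: sJ.
by apply: smoothD; exact: sc.
Qed.

End SasakiTensors.

(** * Invariance under SU(4) *)

(** Entries are indexed by natural numbers so that every minor again has the form of the
    statement. *)
Lemma det_expand (K : comNzRingType) n (f : nat -> nat -> K) :
  \det (\matrix_(i < n.+1, j < n.+1) f i j) =
  \sum_(k < n.+1) f 0 k * ((-1) ^+ k * \det (\matrix_(i < n, j < n) f i.+1 (bump k j))).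
Proof.
rewrite (expand_det_row _ ord0); apply: eq_bigr => k _; rewrite mxE /cofactor add0n.
by congr (_ * (_ * \det _)); apply/matrixP => i j; rewrite !mxE.
Qed.

Lemma det4 (K : comNzRingType) (f : nat -> nat -> K) :
  \det (\matrix_(i < 4, j < 4) f i j) =
  f 0 0 * (f 1 1 * (f 2 2 * f 3 3 - f 2 3 * f 3 2)
           - f 1 2 * (f 2 1 * f 3 3 - f 2 3 * f 3 1)
           + f 1 3 * (f 2 1 * f 3 2 - f 2 2 * f 3 1))
  - f 0 1 * (f 1 0 * (f 2 2 * f 3 3 - f 2 3 * f 3 2)
             - f 1 2 * (f 2 0 * f 3 3 - f 2 3 * f 3 0)
             + f 1 3 * (f 2 0 * f 3 2 - f 2 2 * f 3 0))
  + f 0 2 * (f 1 0 * (f 2 1 * f 3 3 - f 2 3 * f 3 1)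
             - f 1 1 * (f 2 0 * f 3 3 - f 2 3 * f 3 0)
             + f 1 3 * (f 2 0 * f 3 1 - f 2 1 * f 3 0))
  - f 0 3 * (f 1 0 * (f 2 1 * f 3 2 - f 2 2 * f 3 1)
             - f 1 1 * (f 2 0 * f 3 2 - f 2 2 * f 3 0)
             + f 1 2 * (f 2 0 * f 3 1 - f 2 1 * f 3 0)).
Proof.
have det2 (h : nat -> nat -> K) :
    \det (\matrix_(i < 2, j < 2) h i j) = h 0 0 * h 1 1 - h 0 1 * h 1 0.
  by rewrite det_expand !big_ord_recl big_ord0 !det_mx11 !mxE /=; ring.
have det3 (h : nat -> nat -> K) :
    \det (\matrix_(i < 3, j < 3) h i j) = h 0 0 * (h 1 1 * h 2 2 - h 1 2 * h 2 1)
    - h 0 1 * (h 1 0 * h 2 2 - h 1 2 * h 2 0) + h 0 2 * (h 1 0 * h 2 1 - h 1 1 * h 2 0).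
  rewrite det_expand !big_ord_recl big_ord0.
  by rewrite !(det2 (fun i j => h i.+1 (bump _ j))) /=; ring.
rewrite det_expand !big_ord_recl big_ord0.
by rewrite !(det3 (fun i j => f i.+1 (bump _ j))) /=; ring.
Qed.

Section SU4.
Context {R : realType}.
Local Notation E := (R8 R).
Local Notation S7 := (S7 R).
Local Notation C := R[i].
Local Open Scope sesquilinear_scope.
Implicit Types (x y z : E) (s : 'M[C]_4).

Definition zcoord (x : E) (k : nat) : C := Complex (coord x k) (coord x (4 + k)).

Lemma toC_zcoord x (a : 'I_4) : toC x a 0 = zcoord x a.
Proof. by rewrite /zcoord coord_Re coord_Im; case: (toC x a 0). Qed.

Lemma toC_inj : injective (toC : E -> 'cV[C]_4).
Proof.
move=> x y xy; apply: eq_dot => z; rewrite !dotE; move: (coord_toC x) (coord_toC y).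
by rewrite xy => Ex Ey; rewrite !Ex -!Ey.
Qed.

Lemma toC_mact s x : toC (mact s x) = s *m toC x.
Proof. exact: ofCK. Qed.

Lemma toC_Ji x : toC (J Qi x) = 'i *: toC x.
Proof.
rewrite JE toC_qact; apply/colP => a; rewrite !mxE (tnth_nth 0) /=.
by case: a => [[|[|[|[|m]]]] h] //=; rewrite mul0r ?subr0 ?addr0;
  congr (_ * Complex (x _ 0) (x _ 0)); apply: val_inj.
Qed.

Lemma toC_linear (a : R) x y : toC (a *: x + y) = (a%:C)%C *: toC x + toC y.
Proof. by apply/colP => k; rewrite !mxE; simpc. Qed.

Lemma mact_lin s : real_linear (mact s : E -> E).
Proof.
move=> a x y; apply: toC_inj; apply: etrans (toC_mact s _) _.
rewrite toC_linear mulmxDr -scalemxAr -(toC_mact s x) -(toC_mact s y).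
exact: esym (toC_linear _ _ _).
Qed.

Lemma mact_Ji s x : mact s (J Qi x) = J Qi (mact s x).
Proof.
apply: toC_inj; apply: etrans (toC_mact s _) _;
  rewrite toC_Ji -scalemxAr -(toC_mact s x).
exact: esym (toC_Ji _).
Qed.

Lemma mactM s t x : mact (s *m t) x = mact s (mact t x).
Proof. by apply: toC_inj; rewrite !toC_mact mulmxA. Qed.

Lemma mact1 x : mact 1%:M x = x.
Proof. by apply: toC_inj; rewrite toC_mact mul1mx. Qed.

Lemma mact_norm s x : s \is unitarymx -> dot (mact s x) (mact s x) = dot x x.
Proof.
move=> su; have : Complex (dot (mact s x) (mact s x)) 0 = Complex (dot x x) 0.
  rewrite !dot_toC toC_mact trmx_mul map_mxM /= -mulmxA (mulmxA _ s).
  by move: su; rewrite -trmxC_unitary => /unitarymxP; rewrite trmxCK => ->;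
    rewrite mul1mx.
by case.
Qed.

(** Polarization of [mact_norm]. *)
Lemma dot_mact s x y : s \is unitarymx -> dot (mact s x) (mact s y) = dot x y.
Proof.
move=> su; have square (u v : E) : dot (u + v) (u + v) =
  dot u u + 2 * dot u v + dot v v.
  by rewrite dotDl !dotDr (dotC v u); ring.
have := mact_norm (x + y) su; rewrite (linD (mact_lin s)).
move: (mact s x) (mact s y) (mact_norm x su) (mact_norm y su) => u v Eu Ev.
rewrite !square Eu Ev => /addIr/addrI; apply: mulfI.
by rewrite pnatr_eq0.
Qed.

(** The standard complex symplectic form on $\mathbb{C}^4$, which combines the pairings through $j$
    and $k$ into one complex number. *)
Definition symp x y : C :=
  zcoord x 0 * zcoord y 1 - zcoord x 1 * zcoord y 0
    + (zcoord x 2 * zcoord y 3 - zcoord x 3 * zcoord y 2).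

Lemma dot_Jj x y : dot (J Qj x) y = complex.Re (symp x y).
Proof. by rewrite /symp /zcoord !dotE !coord_J /coord_J_rhs; simpc => /=; ring. Qed.

Lemma dot_Jk x y : dot (J Qk x) y = complex.Im (symp x y).
Proof. by rewrite /symp /zcoord !dotE !coord_J /coord_J_rhs; simpc => /=; ring. Qed.

(* Equal to [(symp /\ symp) / 2], which is why [Theta] is SU(4)-invariant although
   [J Qj] and [J Qk] are not. *)
Definition volume p x y z : C :=
  \det (\matrix_(i < 4, j < 4) zcoord (nth 0 [:: p; x; y; z] j) i).

Lemma volume_mact s p x y z :
  volume (mact s p) (mact s x) (mact s y) (mact s z) = \det s * volume p x y z.
Proof.
rewrite /volume -det_mulmx; congr (\det _); apply/matrixP => i j.
have col (v : E) : zcoord (mact s v) i = \sum_k s i k * zcoord v k.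
  by rewrite -toC_zcoord toC_mact mxE; apply: eq_bigr => k _; rewrite toC_zcoord.
rewrite !mxE; have -> : nth 0 [:: mact s p; mact s x; mact s y; mact s z] j =
    mact s (nth 0 [:: p; x; y; z] j) by case: j => [[|[|[|[|m]]]] h].
by rewrite col; apply: eq_bigr => k _; rewrite mxE.
Qed.

Lemma volumeE p x y z : volume p x y z =
  symp p x * symp y z - symp y x * symp p z - symp p y * symp x z.
Proof.
rewrite /volume (@det4 _ (fun i j => zcoord (nth 0 [:: p; x; y; z] j) i)) /= /symp.
by ring.
Qed.

(** The minus sign between the $j$ and $k$ parts of $\Omega$ is the one in
    $\mathrm{Re}(uv)=\mathrm{Re}\,u\,\mathrm{Re}\,v-\mathrm{Im}\,u\,\mathrm{Im}\,v$. *)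
Lemma dot_Theta_volume p x y z : dot (ambient_Theta p x y) z =
  complex.Re (volume p x y z).
Proof.
rewrite volumeE dot_Theta !dot_eta_Phi !(dotC x (J _ _)) !(dotC y (J _ _)) !dot_Jj
  !dot_Jk.
case: (symp p x) (symp y z) (symp y x) => [? ?] [? ?] [? ?].
by case: (symp p z) (symp p y) (symp x z) => [? ?] [? ?] [? ?]; simpc => /=; ring.
Qed.

Lemma dot_Theta_mact s p x y z : \det s = 1 ->
  dot (ambient_Theta (mact s p) (mact s x) (mact s y)) (mact s z) =
    dot (ambient_Theta p x y) z.
Proof. by move=> s1; rewrite !dot_Theta_volume volume_mact s1 mul1r. Qed.

Lemma dot_eta_Phi_isometry t (f : E -> E) p x y z :
  (forall x y, dot (f x) (f y) = dot x y) -> (forall x, f (J t x) = J t (f x)) ->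
  dot (eta_Phi t (f p) (f x) (f y)) (f z) = dot (eta_Phi t p x y) z.
Proof. by move=> fdot fJ; rewrite !dot_eta_Phi -!fJ !fdot. Qed.

Lemma skew_tensor_mact c a b s p x y : s \is unitarymx -> \det s = 1 ->
  skew_tensor c a b (mact s p) (mact s x) (mact s y) = mact s (skew_tensor c a b p x y).
Proof.
move=> su s1.
have surj z : z = mact s (mact (invmx s) z).
  by rewrite -mactM mulmxV ?unitarymx_unit // mact1.
have fdot u v := dot_mact u v su.
have fJ u := mact_Ji s u.
have fW u v w t := dot_Theta_mact u v w t s1.
(* From here only surjectivity, isometry, commutation with $i$ and invariance of $\Omega$ remain;
   every test vector is an image under [f]. *)
move: (mact s) (mact (invmx s)) surj fdot fJ fW => f f' surj fdot fJ fW.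
apply: eq_dot => z'; rewrite (surj z'); move: (f' z') => z.
rewrite fdot !dot_skew_tensor dot_eta_Phi_isometry // fW.
by rewrite (J_skew Qi _ (f z)) -fJ fW (J_skew Qi _ z).
Qed.

End SU4.

(** * Naturality of derivatives under the unitary action *)

Section Push.
Context {R : realType}.
Local Notation E := (R8 R).
Local Notation S7 := (S7 R).
Local Notation C := R[i].
Local Open Scope sesquilinear_scope.
Context (s : 'M[C]_4).
Context (su : s \is unitarymx).

Lemma unitarymx_inv : invmx s \is unitarymx.
Proof. by rewrite (invmx_unitary su) trmxC_unitary. Qed.

Lemma mactK (x : E) : mact (invmx s) (mact s x) = x.
Proof. by rewrite -mactM mulVmx ?unitarymx_unit // mact1. Qed.

Lemma mactVK (x : E) : mact s (mact (invmx s) x) = x.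
Proof. by rewrite -mactM mulmxV ?unitarymx_unit // mact1. Qed.

Lemma mactV_neq0 (x : E) : x != 0 -> mact (invmx s) x != 0.
Proof. by rewrite -(dotxx_eq0 x) -(dotxx_eq0 (mact _ x)) (mact_norm x unitarymx_inv).
  Qed.

Lemma val_tauV (p : S7) : val (tau (invmx s) p) = mact (invmx s) (val p).
Proof. exact/val_tau/unitarymx_inv. Qed.

Lemma val_tauK (p : S7) : val p = mact s (val (tau (invmx s) p)).
Proof. by rewrite val_tauV mactVK. Qed.

(** A unitary matrix preserves norms, hence commutes with normalization. *)
Lemma radext_push (X : S7 -> E) x : x != 0 ->
  radext (push s X) x = mact s (radext X (mact (invmx s) x)).
Proof.
move=> x0; rewrite /radext /push; congr (mact s (X _)); apply: val_inj.
apply: etrans (val_tauV _) _; rewrite !val_normalize ?mactV_neq0 //.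
rewrite (linZ (mact_lin (invmx s))); congr (_ *: _).
by rewrite /invnorm (mact_norm x unitarymx_inv).
Qed.

Lemma vector_field_push (X : S7 -> E) : vector_field X -> vector_field (push s X).
Proof.
move=> [sX tX]; split; last first.
  by move=> p; rewrite /tangent val_tauK /push dot_mact //; exact: tX.
have cX := (smoothP X).1 sX; apply/smoothP => n.
apply: eq_Ck (Ck_lin (mact_lin s) (Ck_comp_lin (mact_lin (invmx s)) mactV_neq0 (cX n))).
by move=> x x0; rewrite radext_push.
Qed.

Lemma deriv_along_push (X Y : S7 -> E) p : vector_field Y ->
  deriv_along (push s X) (push s Y) p = mact s (deriv_along X Y (tau (invmx s) p)).
Proof.
move=> [sY tY]; have p0 := val_neq0 p.
have dY : differentiable (radext Y) (mact (invmx s) (val p)).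
  by apply: radext_differentiable => //; exact: mactV_neq0.
have dYc : differentiable (fun x => radext Y (mact (invmx s) x)) (val p).
  by apply: Ck_diff p0; exact: (Ck_comp_lin (n := 0) (mact_lin (invmx s)) mactV_neq0
    ((smoothP Y).1 sY 0%N)).
apply: etrans (eq_derive_neq0 _ (@radext_push Y) p0) _.
apply: etrans (derive_lin (mact_lin s) _ dYc) _; congr (mact s _).
apply: etrans (derive_comp_lin (mact_lin (invmx s)) _ dY) _.
by rewrite /push mactK -val_tauV.
Qed.

End Push.

(** * The Ricci tensor, the scalar curvature and the Einstein condition *)

Section Corollary.
Context {R : realType}.
Local Notation E := (R8 R).
Local Notation S7 := (S7 R).
Local Notation C := R[i].

Lemma sphere_connection_push s (X Y : S7 -> E) p : s \is unitarymx ->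
  vector_field Y ->
  sphere_connection (push s X) (push s Y) p =
  mact s (sphere_connection X Y (tau (invmx s) p)).
Proof.
move=> su vY; rewrite /sphere_connection deriv_along_push //.
rewrite (linD (mact_lin s)) (linZ (mact_lin s)) -val_tauK //.
by rewrite /push dot_mact.
Qed.

(** Cyclic symmetry moves [x] into the outer inner product, where linearity is evident. *)
Lemma skew_tensor_linl c a b (p y : E) : real_linear (fun x => skew_tensor c a b p x y).
Proof.
move=> k x x'; apply: eq_dot => z.
apply: etrans (dot_skew_tensor_rot c a b p _ y z) _;
  rewrite dotDr dotZr -(dot_skew_tensor_rot c a b p x y z).
rewrite -(dot_skew_tensor_rot c a b p x' y z); exact: esym (dotP _ _ _ _).
Qed.

Lemma skew_tensor_linr c a b (p x : E) : real_linear (skew_tensor c a b p x).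
Proof.
move=> k y y'; rewrite (skew_tensor_swap c a b p (k *: y
  + y')) (skew_tensor_swap c a b p y) (skew_tensor_swap c a b p y').
by rewrite (skew_tensor_linl c a b p x) opprD scalerN.
Qed.

Context {nablag : (S7 -> E) -> (S7 -> E) -> (S7 -> E)}.
Context (hg : levi_civita nablag).
Context (r : R) (q : C).
Local Notation nabla := (nabla_rq nablag r q).
Local Notation Tq p := (skew_tensor r (complex.Re q) (complex.Im q) (val p)).

Lemma nabla_rq_skew X Y p : vector_field X -> vector_field Y ->
  nabla X Y p = nablag X Y p + Tq p (X p) (Y p).
Proof. by move=> [_ tX] [_ tY]; exact: nabla_rqE. Qed.

Let Tt (p : S7) (x y : E) : tangent p x -> tangent p y -> tangent p (Tq p x y).
Proof. by move=> _ _; exact: tangent_skew_tensor. Qed.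

Let Ts (X Y : S7 -> E) : vector_field X -> vector_field Y ->
  smooth (fun p => Tq p (X p) (Y p)).
Proof. by move=> [sX _] [sY _]; exact: smooth_skew_tensor. Qed.

Let Ta (p : S7) (x y z : E) : tangent p x -> tangent p y -> tangent p z ->
  dot (Tq p y x) z = - dot (Tq p x y) z /\ dot (Tq p x z) y = - dot (Tq p x y) z.
Proof. by move=> _ _ _; rewrite skew_tensor_swap dotNl; split;
  [|exact: dot_skew_tensor_swap]. Qed.

Lemma affine_nabla_rq : affine_connection nabla.
Proof.
have [[_ [addl [scall [addr leib]]]] _] := hg; split; [|split; [|split; [|split]]].
- exact: (vector_field_nabla hg nabla_rq_skew Tt Ts).
- move=> X X' Y vX vX' vY; apply/funext => p.
  rewrite !nabla_rq_skew //; last exact: vector_fieldD.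
  by rewrite addl // (linD (skew_tensor_linl _ _ _ _ _)) addrACA.
- move=> f X Y sf vX vY; apply/funext => p.
  rewrite !nabla_rq_skew //; last exact: vector_field_scale.
  by rewrite scall // (linZ (skew_tensor_linl _ _ _ _ _)) [RHS]scalerDr.
- move=> X Y Y' vX vY vY'; apply/funext => p.
  rewrite !nabla_rq_skew //; last exact: vector_fieldD.
  by rewrite addr // (linD (skew_tensor_linr _ _ _ _ _)) addrACA.
move=> f X Y sf vX vY; apply/funext => p.
rewrite !nabla_rq_skew //; last exact: vector_field_scale.
by rewrite leib // (linZ (skew_tensor_linr _ _ _ _ _)) [X in _ = _ + X]scalerDr addrA.
Qed.

Lemma SU4_nabla_rq : SU4_invariant nabla.
Proof.
move=> s su s1 X Y vX vY; apply/funext => p.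
have vX' := vector_field_push su vX; have vY' := vector_field_push su vY.
rewrite (nabla_rq_skew p vX' vY') (levi_civita_sphere hg vX' vY')
  sphere_connection_push //.
rewrite {1}/push (nabla_rq_skew _ vX vY) (levi_civita_sphere hg vX vY) (linD (mact_lin
  s)).
by congr (_ + _); rewrite [in RHS](val_tauK su p) [RHS]skew_tensor_mact.
Qed.

Lemma metric_nabla_rq : metric_connection nabla.
Proof. exact: (metric_nabla hg nabla_rq_skew Ta). Qed.

Lemma skew_torsion_nabla_rq : skew_torsion nabla.
Proof. exact: (skew_torsion_nabla hg nabla_rq_skew Tt Ts Ta). Qed.

Lemma normc_sqr : Normc.normc q ^+ 2 = complex.Re q ^+ 2 + complex.Im q ^+ 2.
Proof. by case: q => a b /=; rewrite sqr_sqrtr // addr_ge0 // sqr_ge0. Qed.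

Lemma SymRic_nabla_rq Y Z p : vector_field Y -> vector_field Z ->
  SymRic nabla Y Z p =
  (6 - 2 * r ^+ 2 - 4 * Normc.normc q ^+ 2) * g Y Z p
  + 4 * (Normc.normc q ^+ 2 - r ^+ 2) * (eta 0 p (Y p) * eta 0 p (Z p)).
Proof.
move=> vY vZ; rewrite (SymRic_nabla hg nabla_rq_skew Tt Ts Ta) //.
under eq_bigr => i _ do rewrite !skew_tensor_tproj.
rewrite gram_skew_tensor normc_sqr !(etaE p Qi) /gram_form /g dot_valP.
have [_ tY] := vY; rewrite (dotC (val p)) [dot (Y p) (val p)]tY.
by ring.
Qed.

Lemma sum_eta_sqr (p : S7) :
  \sum_(i < 8) eta 0 p (tproj p (e_ i)) * eta 0 p (tproj p (e_ i)) = 1 :> R.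
Proof.
have tJ : tangent p (J Qi (val p)) by rewrite /tangent dotC J_diag.
have E1 i : eta 0 p (tproj p (e_ i)) * eta 0 p (tproj p (e_ i)) =
    dot (J Qi (val p)) (e_ i) * dot (e_ i) (J Qi (val p)).
  by rewrite (etaE p Qi) dot_tproj // mulrNN (dotC (J Qi _)).
by rewrite (eq_bigr _ (fun i _ => E1 i)) parseval J_isom dot_valP.
Qed.

Lemma scalar_nabla_rq p :
  scalar_curvature nabla p = 6 * (7 - 3 * r ^+ 2 - 4 * Normc.normc q ^+ 2).
Proof.
have E1 i : Ric nabla (ext (tproj p (e_ i))) (ext (tproj p (e_ i))) p =
    (6 - 2 * r ^+ 2 - 4 * Normc.normc q ^+ 2)
      * dot (tproj p (e_ i)) (tproj p (e_ i))
    + 4 * (Normc.normc q ^+ 2 - r ^+ 2)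
      * (eta 0 p (tproj p (e_ i)) * eta 0 p (tproj p (e_ i))).
  have ve := vector_field_ext (tproj p (e_ i)).
  have ee : ext (tproj p (e_ i)) p = tproj p (e_ i).
    exact/tproj_tangent/tangent_tproj.
  (* On the diagonal [Ric] and [SymRic] agree. *)
  have := SymRic_nabla_rq p ve ve; rewrite /g ee => <-.
  by rewrite /SymRic; field.
rewrite /scalar_curvature /gtrace_at (eq_bigr _ (fun i _ => E1 i)).
by rewrite big_split -!mulr_sumr /= sum_dot_tproj sum_eta_sqr; ring.
Qed.

Lemma einstein_nabla_rq : nabla_einstein nabla <-> Normc.normc q ^+ 2 = r ^+ 2.
Proof.
split=> [[_ [_ Ein]]|qr]; last first.
  split; first exact: metric_nabla_rq.
  split; first exact: skew_torsion_nabla_rq.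
  by move=> Y Z vY vZ p; rewrite SymRic_nabla_rq // scalar_nabla_rq qr; field.
(* Testing along $ip=-\xi_1$, where $\eta_1\otimes\eta_1$ and $g$ both equal 1, gives
   $6-6r^2=\frac67(7-3r^2-4|q|^2)$, which forces $|q|^2=r^2$. *)
pose p : S7 := base_point; pose v := J Qi (val p).
have pv : tangent p v by rewrite /tangent dotC J_diag.
have ve : vector_field (ext v) := vector_field_ext v.
have ee : ext v p = v by exact: tproj_tangent.
have := Ein _ _ ve ve p; rewrite SymRic_nabla_rq // scalar_nabla_rq /g ee.
rewrite (etaE p Qi) /v J_isom dot_valP.
by move: (Normc.normc q ^+ 2) (r ^+ 2) => k l; lra.
Qed.

End Corollary.

Theorem corollary5p15 (R : realType)
    (nablag : (S7 R -> R8 R) -> (S7 R -> R8 R) -> (S7 R -> R8 R))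
    (hg : levi_civita nablag) (r : R) (q : R[i]) :
  let nabla := nabla_rq nablag r q in
  let q2 := Normc.normc q ^+ 2 in
  (affine_connection nabla /\ SU4_invariant nabla /\
   metric_connection nabla /\ skew_torsion nabla) /\
  (forall Y Z, vector_field Y -> vector_field Z -> forall p,
     SymRic nabla Y Z p =
     (6 - 2 * r ^+ 2 - 4 * q2) * g Y Z p
     + 4 * (q2 - r ^+ 2) * (eta 0 p (Y p) * eta 0 p (Z p))) /\
  (forall p, scalar_curvature nabla p = 6 * (7 - 3 * r ^+ 2 - 4 * q2)) /\
  (nabla_einstein nabla <-> q2 = r ^+ 2) /\
  (q2 = r ^+ 2 ->
   forall Y Z, vector_field Y -> vector_field Z -> forall p,
     SymRic nabla Y Z p = 6 * (1 - r ^+ 2) * g Y Z p).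
Proof.
move=> nabla q2; split; [split; [|split; [|split]]|split; [|split; [|split]]].
- exact: affine_nabla_rq.
- exact: SU4_nabla_rq.
- exact: metric_nabla_rq.
- exact: skew_torsion_nabla_rq.
- by move=> Y Z vY vZ p; exact: SymRic_nabla_rq.
- exact: scalar_nabla_rq.
- exact: einstein_nabla_rq.
by move=> qr Y Z vY vZ p; rewrite SymRic_nabla_rq // -/q2 qr; ring.
Qed.
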